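(* Let $f=\sum_{i=1}^m f_i$ be twice differentiable with Lipschitz derivatives, with constants $L_2=\sup_\omega\|\nabla^2 f(\omega)\|$ and $L_3=\sup_\omega\|\nabla^3 f(\omega)\|$ ($L_3$ being the Lipschitz constant of $\nabla^2 f$), and assume $\beta<1$. Let $(\bm\omega^t,\mathbf g^t,\aleph^t)$ be generated by the decentralized Metropolis-adjusted algorithm with step-size $\epsilon>0$ defined in the context, and let $\bar{\bm\omega}^t,\bar{\mathbf g}^t,\bar\aleph^t$ be the corresponding averages over agents. Then there is a constant $\hat C>0$ depending on $L_2$, $L_3$ and $\epsilon$ such that for all $t$ $$\mathbb{E}\|\bar{\bm{\omega}}^{t}-\bm{\omega}^{t}\| +\mathbb{E}\|\bar{\mathbf{g}}^{t}-\mathbf{g}^{t}\|+ \mathbb{E}\|\bar\aleph^{t}-\aleph^{t}\| \le \frac{\epsilon\, \hat C \left\|\mathbf{M}\right\|}{1-\beta}$$ and $$\mathbb{E}\|\bar{\bm{\omega}}^{t}-\bm{\omega}^{t}\|^2 +\mathbb{E}\|\bar{\mathbf{g}}^{t}-\mathbf{g}^{t}\|^2+ \mathbb{E}\|\bar\aleph^{t}-\aleph^{t}\|^2 \le \frac{\epsilon^2 \hat C \left\|\mathbf{M}\right\|^2}{1-\beta^2}.$$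
   Context: Data are distributed over $m$ agents. For $i=1,\dots,m$, $f_i:\mathbb R^d\to\mathbb R$ is the (unnormalized) local log-posterior of agent $i$ given its data, $f=\sum_i f_i$ is the global log-posterior, and $U_i=-f_i$ is the local potential. All norms are Euclidean or the induced operator norms. Network: the agents are the vertices of a fixed undirected connected graph with edge set $\mathcal E$ (self-loops allowed). $\mathbf A\in\mathbb R^{m\times m}$ is a symmetric doubly stochastic matrix with $\mathbf A_{ij}\ne0$ if $(i,j)\in\mathcal E$ and $\mathbf A_{ij}=0$ otherwise, and $\mathbf W=\mathbf A\otimes\mathbf I$ acts on stacked vectors by mixing blocks: $(\mathbf W\bm\omega)_i=\sum_j\mathbf A_{ij}\omega_j$ (and as $\mathbf A$ on vectors of $m$ scalars). The eigenvalues of $\mathbf A$ are sorted as $1=\lambda_1>\lambda_2\ge\dots\ge\lambda_m\ge0$, and $\beta:=\lambda_2$. $\mathbf W^t$ is the $t$-th power of $\mathbf W$. Stacked vectors: $\bm\omega^t=(\omega_1^t,\dots,\omega_m^t)\in(\mathbb R^d)^m$, $\mathbf g^t=(g_1^t,\dots,g_m^t)\in(\mathbb R^d)^m$, $\aleph^t\in\mathbb R^m$. A bar denotes the stacked vector all of whose blocks equal the average over agents, e.g. $\bar\omega^t_i=\frac1m\sum_j\omega^t_j$ for every $i$. Random inputs: for each $t$, $\mathbf p^t=(p_1^t,\dots,p_m^t)$ with $p_i^t\sim\mathcal N(0,\mathbf M)$ in $\mathbb R^d$, and $u^t=(u_1^t,\dots,u_m^t)$ with $u_i^t$ uniform on $(0,1)$;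 all independent. Let $G(\bm\omega)=(\nabla f_1(\omega_1),\dots,\nabla f_m(\omega_m))$ and $H^t(\bm\omega)=\big((p_i^t)^T\nabla^2U_i(\omega_i)p_i^t\big)_{i=1}^m$. Algorithm: from given initial values $\bm\omega^0,\bm\omega^1,\mathbf g^1,\aleph^1$, for $t\ge1$, $$\mathbf g^{t+1}=\mathbf W^t\big(\mathbf g^t+G(\bm\omega^t)-G(\bm\omega^{t-1})\big),\quad \aleph^{t+1}=\mathbf W^t\big(\aleph^t+H^t(\bm\omega^t)-H^{t-1}(\bm\omega^{t-1})\big),\quad \bm\omega^{t+1}=\mathbf W^t\mathcal M^t,$$ where block $i$ of $\mathcal M^t$ is the proposal $\omega_i^t+\epsilon(p_i^t+\epsilon g_i^{t+1})$ if $\min\{0,-\tfrac12\epsilon^2(\aleph_i^{t+1}+\|g_i^{t+1}\|^2)\}\ge\log u_i^t$, and is $\omega_i^t$ otherwise.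
   Formalization: L2, L3 bound the local f_i, not only the sum f; the constant C may also depend on m, d, the initial values and a lower bound kappa>0 of ||M|| (so M≠0). As printed the claim fails: at t=1 the left sides depend only on arbitrary initial values, and M=0 makes the right sides 0. *)

(* Defs.v *)
From HB Require Import structures.
From mathcomp Require Export all_boot all_order all_algebra.
From mathcomp Require Export all_classical all_reals all_analysis.

Set Implicit Arguments.
Unset Strict Implicit.
Unset Printing Implicit Defensive.

Export Order.TTheory GRing.Theory Num.Theory.
Export numFieldNormedType.Exports.

Local Open Scope classical_set_scope.
Local Open Scope ring_scope.

(* Points of R^d are row vectors.  A stacked vector with m blocks in R^d is an
   m x d matrix whose i-th row is the block of agent i (a vector of m scalars
   is an m x 1 matrix), so that the action of A (x) I on it is [A *m w]. *)

Section norms.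
Context {R : realType}.

(* The canonical norm of 'M_(m, n) in the library is the max norm; this is the
   Euclidean norm of the vector of all entries. *)
Definition enorm (m n : nat) (x : 'M[R]_(m, n)) : R :=
  Num.sqrt (\sum_i \sum_j x i j ^+ 2).

Definition opnorm (n : nat) (B : 'M[R]_n) : R :=
  sup [set enorm (B *m x) | x in [set x : 'cV[R]_n | enorm x <= 1]].

Definition average (m n : nat) (x : 'M[R]_(m, n)) : 'M[R]_(m, n) :=
  \matrix_(i, j) (m%:R^-1 * \sum_k x k j).

Definition qform (n : nat) (B : 'M[R]_n) (x : 'rV[R]_n) : R :=
  (x *m B *m x^T) 0 0.

End norms.

Section derivatives.
Context {R : realType} {d : nat}.

Definition grad (h : 'rV[R]_d -> R) (x : 'rV[R]_d) : 'rV[R]_d :=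
  \row_j 'D_(delta_mx 0 j) h x.

Definition hess (h : 'rV[R]_d -> R) (x : 'rV[R]_d) : 'M[R]_d :=
  jacobian (grad h) x.

Definition twice_differentiable (h : 'rV[R]_d -> R) : Prop :=
  (forall x, differentiable h x) /\ (forall x, differentiable (grad h) x).

(* The suprema are taken over the points and over the agents, i.e. they are
   the constants of the derivatives of the map sending a stacked vector w to
   \sum_i f i (row i w), whose Hessian is block diagonal. *)
Definition sup_hess (m : nat) (f : 'I_m -> 'rV[R]_d -> R) : \bar R :=
  ereal_sup [set r | exists i x, r = (opnorm (hess (f i) x))%:E].

Definition lip_hess (m : nat) (f : 'I_m -> 'rV[R]_d -> R) : \bar R :=
  ereal_sup [set r | exists i x y, x != y /\
    r = (opnorm (hess (f i) x - hess (f i) y) / enorm (x - y))%:E].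

End derivatives.

Section network.
Context {R : realType} {m : nat}.

Definition connected_graph (E : rel 'I_m) : Prop :=
  symmetric E /\ forall i j, connect E i j.

Definition doubly_stochastic (A : 'M[R]_m) : Prop :=
  [/\ forall i j, 0 <= A i j,
      forall i, \sum_j A i j = 1 &
      forall j, \sum_i A i j = 1].

(* lam lists the eigenvalues with multiplicity, in nonincreasing order. *)
Definition sorted_spectrum (A : 'M[R]_m) (lam : m.-tuple R) : Prop :=
  char_poly A = \prod_(l <- lam) ('X - l%:P) /\ sorted >=%R lam.

(* With 0-based indexing, lam`_0 and lam`_1 are the two largest eigenvalues. *)
Definition gossip_matrix (E : rel 'I_m) (A : 'M[R]_m) (lam : m.-tuple R) :
    Prop :=
  [/\ connected_graph E,
      A^T = A /\ doubly_stochastic A,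
      forall i j, (A i j != 0) = E i j,
      sorted_spectrum A lam &
      [/\ lam`_0 = 1, lam`_1 < 1 & forall k : 'I_m, 0 <= tnth lam k]].

End network.

Section randomness.
Context {R : realType} {dO : measure_display} {Om : measurableType dO}.
Variable P : probability Om R.

Definition borel_rV (d : nat) : set (set 'rV[R]_d) :=
  <<s [set B : set 'rV[R]_d | open B] >>.

Definition random_vector (d : nat) (X : Om -> 'rV[R]_d) : Prop :=
  forall B, borel_rV B -> measurable (X @^-1` B).

Definition covariance_matrix (d : nat) (M : 'M[R]_d) : Prop :=
  M^T = M /\ forall x : 'rV[R]_d, 0 <= qform M x.

(* The law N(0, v).  The case v = 0 is separate because normal_prob _ 0 is
   not a Dirac mass in the library. *)
Definition centered_normal (v : R) (B : set R) : \bar R :=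
  if v == 0 then \d_(0 : R) B else normal_prob 0 (Num.sqrt v) B.

(* N(0, M) is the law all of whose one-dimensional projections <a, .> are
   N(0, a M a^T); this also makes sense when M is singular. *)
Definition gaussian_vector (d : nat) (M : 'M[R]_d) (X : Om -> 'rV[R]_d) :
    Prop :=
  random_vector X /\
  forall (a : 'rV[R]_d) (B : set R), measurable B ->
    P ((fun o => (X o *m a^T) 0 0) @^-1` B) = centered_normal (qform M a) B.

Definition uniform01_variable (X : Om -> R) : Prop :=
  measurable_fun setT X /\
  forall B : set R, measurable B -> P (X @^-1` B) = uniform_prob (@ltr01 R) B.

(* Mutual independence of a family of classes of events. *)
Definition mutually_independent (I : eqType) (F : I -> set (set Om)) : Prop :=
  forall (s : seq I) (B : I -> set Om), uniq s ->
    (forall k, k \in s -> F k (B k)) ->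
    P (\bigcap_(k in [set k | k \in s]) B k) = (\prod_(k <- s) P (B k))%E.

Definition generated_events (m d : nat) (p : nat -> 'I_m -> Om -> 'rV[R]_d)
    (u : nat -> 'I_m -> Om -> R) (k : nat * 'I_m + nat * 'I_m) :
    set (set Om) :=
  match k with
  | inl (t, i) => [set p t i @^-1` B | B in @borel_rV d]
  | inr (t, i) => [set u t i @^-1` B | B in [set B : set R | measurable B]]
  end.

Definition random_inputs (m d : nat) (M : 'M[R]_d)
    (p : nat -> 'I_m -> Om -> 'rV[R]_d) (u : nat -> 'I_m -> Om -> R) : Prop :=
  [/\ forall t i, gaussian_vector M (p t i),
      forall t i, uniform01_variable (u t i) &
      mutually_independent (generated_events p u)].

End randomness.

Section algorithm.
Context {R : realType} {m d : nat}.

Definition stacked_grad (f : 'I_m -> 'rV[R]_d -> R) (w : 'M[R]_(m, d)) :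
    'M[R]_(m, d) :=
  \matrix_(i < m) grad (f i) (row i w).

Definition potential (f : 'I_m -> 'rV[R]_d -> R) (i : 'I_m) (x : 'rV[R]_d) :
    R := - f i x.

Definition stacked_hess (f : 'I_m -> 'rV[R]_d -> R) (p : 'I_m -> 'rV[R]_d)
    (w : 'M[R]_(m, d)) : 'cV[R]_m :=
  \col_(i < m) qform (hess (potential f i) (row i w)) (p i).

Definition metropolis_step (eps : R) (p : 'I_m -> 'rV[R]_d) (u : 'I_m -> R)
    (w g : 'M[R]_(m, d)) (al : 'cV[R]_m) : 'M[R]_(m, d) :=
  \matrix_(i < m)
    if ln (u i) <=
       Num.min 0 (- (2^-1 * eps ^+ 2 * (al i 0 + enorm (row i g) ^+ 2)))
    then row i w + eps *: (p i + eps *: row i g)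
    else row i w.

(* g and al are only constrained at times t >= 1. *)
Definition decentralized_mala {Om : Type} (f : 'I_m -> 'rV[R]_d -> R)
    (A : 'M[R]_m) (eps : R)
    (p : nat -> 'I_m -> Om -> 'rV[R]_d) (u : nat -> 'I_m -> Om -> R)
    (w0 w1 g1 : 'M[R]_(m, d)) (al1 : 'cV[R]_m)
    (w g : nat -> Om -> 'M[R]_(m, d)) (al : nat -> Om -> 'cV[R]_m) : Prop :=
  forall o : Om,
  [/\ w 0%N o = w0, w 1%N o = w1, g 1%N o = g1, al 1%N o = al1 &
    forall t : nat, (1 <= t)%N ->
    [/\ g t.+1 o = A ^+ t *m
          (g t o + stacked_grad f (w t o) - stacked_grad f (w t.-1 o)),
        al t.+1 o = A ^+ t *m
          (al t o + stacked_hess f (fun i => p t i o) (w t o)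
                  - stacked_hess f (fun i => p t.-1 i o) (w t.-1 o)) &
        w t.+1 o = A ^+ t *m
          metropolis_step eps (fun i => p t i o) (fun i => u t i o)
            (w t o) (g t.+1 o) (al t.+1 o)]].

End algorithm.

(* Main.v *)
Require Import Defs.
From HB Require Import structures.
From mathcomp Require Import ring lra measurable_realfun.
Set Implicit Arguments.
Unset Strict Implicit.
Unset Printing Implicit Defensive.
Local Open Scope classical_set_scope.
Local Open Scope ring_scope.

(* The gossip matrix is diagonalized in an orthonormal basis, where W^t acts on
   the component of eigenvalue l by l^t, and the consensus error is the norm of
   the components other than the constant one.  Every bound is an L^2 bound.

   The increments of aleph telescope: al^(t+1) - H^t evolves by convex
   combinations, so aleph stays of order ||M||.  A proposal is accepted only if
   eps^2 |g|^2 <= - eps^2 al - 2 ln u, so the displacements of omega are of order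
   ||M|| as well, even though the gradients are unbounded.  The components of
   omega obey z' = l^t (z + e) with e bounded; because the exponent grows with
   t, this gives |z| = O((1 - l)^(-1/2)) and, crucially, (1 - l^t) z = O(1).
   Hence the increments of omega are O(1), and so are those of the gradients by
   Lipschitz continuity, and the components of g obey the same recursion.  The
   first moments follow from the second ones by 2 D <= D^2 / ||M|| + ||M||. *)

(** * The spectral theorem for real symmetric matrices *)

Lemma char_poly_conj (F : comNzRingType) n (P A Pi : 'M[F]_n) :
  P *m Pi = 1%:M -> char_poly (P *m A *m Pi) = char_poly A.
Proof.
move=> PPi; rewrite /char_poly.
have -> : char_poly_mx (P *m A *m Pi) =
    map_mx polyC P *m char_poly_mx A *m map_mx polyC Pi.
  rewrite /char_poly_mx mulmxBr mulmxBl !map_mxM; congr (_ - _).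
  by rewrite mul_mx_scalar -scalemxAl -map_mxM PPi map_mx1 scalemx1.
rewrite !det_mulmx mulrC mulrA -det_mulmx -map_mxM.
by rewrite (mulmx1C PPi) map_mx1 det1 mul1r.
Qed.

Lemma char_poly_block_diag (F : comNzRingType) n1 n2 (A : 'M[F]_n1)
    (B : 'M[F]_n2) :
  char_poly (block_mx A 0 0 B) = char_poly A * char_poly B.
Proof.
rewrite /char_poly /char_poly_mx map_block_mx !map_mx0 -(det_lblock _ 0).
by rewrite scalar_mx_block opp_block_mx add_block_mx !oppr0 !addr0.
Qed.

Section orthogonal.
Context {F : rcfType}.

Lemma mul_trmx_ge0 n (u : 'rV[F]_n) : 0 <= (u *m u^T) 0 0.
Proof. by rewrite mxE sumr_ge0 // => i _; rewrite mxE -expr2 sqr_ge0. Qed.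

Lemma mul_trmx_eq0 n (u : 'rV[F]_n) : (u *m u^T) 0 0 = 0 -> u = 0.
Proof.
rewrite mxE => /eqP; rewrite psumr_eq0; last first.
  by move=> i _; rewrite mxE -expr2 sqr_ge0.
move=> /allP h; apply/rowP => i; rewrite [RHS]mxE.
have := h i (mem_index_enum i).
by rewrite mxE -expr2 sqrf_eq0 => /eqP.
Qed.

(* The reflection exchanging the first basis vector and [v]. *)
Lemma householder n (v : 'rV[F]_(1 + n)) : v *m v^T = 1%:M ->
  exists P : 'M[F]_(1 + n), P *m P^T = 1%:M /\ delta_mx 0 0 *m P = v.
Proof.
move=> vv; set e : 'rV[F]_(1 + n) := delta_mx 0 0.
have ee : e *m e^T = 1%:M.
  by rewrite trmx_delta mul_delta_mx; apply/matrixP => i j; rewrite !ord1 !mxE.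
have [ve|ve] := eqVneq v e.
  exists 1%:M; split; first by rewrite trmx1 mul1mx.
  by rewrite ve; exact: mulmx1.
pose u := e - v; pose q := (u *m u^T) 0 0.
have uu : u *m u^T = q%:M by rewrite [LHS]mx11_scalar.
have q0 : q != 0.
  by apply/eqP => /mul_trmx_eq0 /eqP; rewrite subr_eq0 eq_sym (negbTE ve).
(* [P] is the reflection in the hyperplane orthogonal to [u = e - v]. Since [e] and [v] are unit
   vectors, [e *m u^T] is half of [u *m u^T], so [e] is sent to [e - u = v]. *)
pose P := 1%:M - (2 / q) *: (u^T *m u).
have PT : P^T = P by rewrite /P linearB /= trmx1 linearZ /= trmx_mul trmxK.
exists P; split.
  rewrite PT {1}/P mulmxBl mul1mx -scalemxAl {2}/P mulmxBr mulmx1 -scalemxAr.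
  rewrite scalerBr.
  rewrite mulmxA -(mulmxA u^T) uu mul_mx_scalar -scalemxAl !scalerA.
  have -> : 2 / q * (2 / q * q) = 2 / q + 2 / q by field.
  by rewrite scalerDl opprB addrK subrK.
have eu : e *m u^T = (q / 2)%:M.
  have ev : v *m e^T = e *m v^T.
    by rewrite -[LHS]trmxK trmx_mul trmxK [e *m v^T]mx11_scalar tr_scalar_mx.
  have : u *m u^T = 2%:R *: (e *m u^T).
    rewrite /u linearB /= !mulmxBl !mulmxBr ee vv ev.
    by apply/matrixP => i j; rewrite !mxE; ring.
  by rewrite uu => h; rewrite mulrC -scale_scalar_mx h scalerA mulVf
    ?scale1r ?pnatr_eq0.
rewrite /P mulmxBr mulmx1 -scalemxAr mulmxA eu mul_scalar_mx scalerA.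
by rewrite mulrA divfK // divff ?pnatr_eq0 // scale1r opprB addrC subrK.
Qed.

Lemma unit_eigenvector n (A : 'M[F]_n) l : eigenvalue A l ->
  exists v : 'rV[F]_n, v *m v^T = 1%:M /\ v *m A = l *: v.
Proof.
move=> /eigenvalueP[v vA v0].
have q0 : 0 < (v *m v^T) 0 0.
  rewrite lt_def mul_trmx_ge0 andbT.
  by apply/eqP => /mul_trmx_eq0 /eqP; rewrite (negbTE v0).
exists ((Num.sqrt ((v *m v^T) 0 0))^-1 *: v); split; last first.
  by rewrite -scalemxAl vA !scalerA mulrC.
rewrite linearZ /= -scalemxAl -scalemxAr scalerA [X in _ *: X]mx11_scalar.
by rewrite scale_scalar_mx -expr2 exprVn sqr_sqrtr ?ltW // mulVf ?gt_eqF.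
Qed.

Theorem symmetric_spectral n (A : 'M[F]_n) (s : seq F) :
  A^T = A -> char_poly A = \prod_(l <- s) ('X - l%:P) ->
  exists Q : 'M[F]_n,
    Q *m Q^T = 1%:M /\ Q *m A = diag_mx (\row_k s`_k) *m Q.
Proof.
elim: n A s => [|n IH] A s AT hs.
  by exists 1%:M; split; apply/matrixP => -[].
case: s hs => [|l s] hs.
  have := size_char_poly A.
  by rewrite hs big_nil size_poly1.
have /unit_eigenvector[v [vv vA]] : eigenvalue A l.
  by rewrite eigenvalue_root_char hs big_cons rootM root_XsubC eqxx.
have [P [PP ev]] := householder (n := n) vv.
have PP' := mulmx1C PP.
pose B : 'M[F]_(1 + n) := P *m A *m P^T.
have BT : B^T = B by rewrite /B !trmx_mul trmxK AT mulmxA.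
have eB : delta_mx (0 : 'I_1) 0 *m B = l *: delta_mx 0 0.
  by rewrite /B !mulmxA ev vA -scalemxAl -ev -mulmxA PP mulmx1.
have B0 j : B 0 j = l *+ (j == 0).
  have := congr1 (fun M : 'rV_(1 + n) => M 0 j) eB.
  by rewrite -rowE !mxE eqxx /= mulr_natr.
have PA : P *m A = B *m P by rewrite /B -mulmxA PP' mulmx1.
have chB : char_poly B = char_poly A by exact: char_poly_conj.
clearbody B; pose A' : 'M[F]_n := drsubmx B.
have Bblock : B = block_mx l%:M 0 0 A'.
  rewrite -[LHS]submxK; congr block_mx.
  - by apply/matrixP => i j; rewrite !ord1 !mxE lshift0 B0 eqxx.
  - by apply/matrixP => i j; rewrite !mxE ord1 lshift0 B0.
  - by apply/matrixP => i j; rewrite !mxE ord1 lshift0 -BT mxE B0.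
have A'T : A'^T = A'.
  by rewrite /A' trmx_drsub BT.
have chA' : char_poly A' = \prod_(k <- s) ('X - k%:P).
  have h : char_poly B = ('X - l%:P) * char_poly A'.
    rewrite Bblock (char_poly_block_diag l%:M A'); congr (_ * _).
    by rewrite /char_poly det_mx11 !mxE eqxx.
  move: h; rewrite chB hs big_cons => /mulfI -> //.
  by rewrite polyXsubC_eq0.
have [Q [QQ QA]] := IH A' s A'T chA'.
pose X : 'M[F]_(1 + n) := block_mx 1%:M 0 0 Q.
have XX : X *m X^T = 1%:M.
  rewrite /X tr_block_mx mulmx_block !trmx0 trmx1 !mulmx0 !mul0mx !addr0 !add0r.
  by rewrite mulmx1 QQ -scalar_mx_block.
exists (X *m P); split.
  by rewrite trmx_mul !mulmxA -(mulmxA _ P) PP mulmx1.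
have -> : diag_mx (\row_k (l :: s)`_k) =
    block_mx l%:M 0 0 (diag_mx (\row_k s`_k)) :> 'M[F]_(1 + n).
  have -> : \row_k (l :: s)`_k = row_mx (l%:M : 'M[F]_1) (\row_(k < n) s`_k).
    apply/rowP => j; rewrite !mxE.
    by case: splitP => k -> ; rewrite ?ord1 !mxE.
  by rewrite diag_mx_row; congr block_mx; apply/matrixP => i j;
    rewrite !ord1 !mxE.
have XB : X *m block_mx l%:M 0 0 A' =
    block_mx (l%:M : 'M[F]_1) 0 0 (diag_mx (\row_(k < n) s`_k)) *m X.
  rewrite /X !mulmx_block !mulmx0 !mul0mx mulmx1 mul1mx.
  by rewrite !addr0 !add0r QA.
by rewrite -mulmxA PA Bblock mulmxA XB mulmxA.
Qed.
End orthogonal.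

(** * Upper means and the damped recursion *)

(** Holds for arbitrary nonnegative functions, because the integral is a supremum over the simple
    functions lying below. *)
Lemma ge0_le_integralT d (T : measurableType d) (R : realType)
    (mu : {measure set T -> \bar R}) (f g : T -> \bar R) :
  (forall x, 0 <= f x)%E -> (forall x, f x <= g x)%E ->
  (\int[mu]_x f x <= \int[mu]_x g x)%E.
Proof.
move=> f0 fg; have g0 x : (0 <= g x)%E by exact: le_trans (f0 x) (fg x).
rewrite !ge0_integralTE //.
apply: ge_ereal_sup => _ [h hf <-]; apply: ereal_sup_ubound.
by exists h => // x; exact: le_trans (hf x) (fg x).
Qed.

Section upper_mean.
Context {R : realType} {dO : measure_display} {Om : measurableType dO}.
Context (P : probability Om R).
Implicit Types X Y : Om -> R.

(* The processes need not be known to be measurable: this is an upper bound on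
   the upper integral of X, which is subadditive and monotone on all functions,
   and which dominates the library's (lower) integral. *)
Definition mean_le X (v : R) : Prop :=
  exists Y, [/\ measurable_fun setT Y, forall o, 0 <= Y o,
    forall o, X o <= Y o & (\int[P]_o (Y o)%:E <= v%:E)%E].

Lemma le_expectation_mean_le X v :
  (forall o, 0 <= X o) -> mean_le X v -> ('E_P[X] <= v%:E)%E.
Proof.
move=> X0 [Y [mY Y0 XY hY]]; rewrite unlock; apply: le_trans hY.
by apply: ge0_le_integralT => o; rewrite lee_fin.
Qed.

Lemma mean_le_mono X Y v : (forall o, X o <= Y o) -> mean_le Y v -> mean_le X v.
Proof.
move=> XY [Z [mZ Z0 YZ hZ]]; exists Z; split => // o.
exact: le_trans (XY o) (YZ o).
Qed.

Lemma mean_le_weak X v v' : v <= v' -> mean_le X v -> mean_le X v'.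
Proof.
move=> vv' [Z [mZ Z0 YZ hZ]]; exists Z; split => //.
by apply: le_trans hZ _; rewrite lee_fin.
Qed.

Lemma mean_le_cst c : 0 <= c -> mean_le (fun=> c) c.
Proof.
move=> c0; exists (fun=> c); split => //.
by rewrite integral_cst //= probability_setT mule1.
Qed.

Lemma mean_leD X Y v v' : mean_le X v -> mean_le Y v' ->
  mean_le (fun o => X o + Y o) (v + v').
Proof.
move=> [X' [mX X0 XX hX]] [Y' [mY Y0 YY hY]].
exists (fun o => X' o + Y' o); split.
- exact: measurable_funD.
- by move=> o; rewrite addr_ge0.
- by move=> o; rewrite lerD.
- under eq_integral do rewrite EFinD.
  rewrite ge0_integralD //=; [|by move=> o _; rewrite lee_fin|
    exact/measurable_EFinP|by move=> o _; rewrite lee_fin|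
    exact/measurable_EFinP].
  by rewrite EFinD leeD.
Qed.

Lemma mean_leZ a X v : 0 <= a -> mean_le X v ->
  mean_le (fun o => a * X o) (a * v).
Proof.
move=> a0 [X' [mX X0 XX hX]]; exists (fun o => a * X' o); split.
- exact: measurable_funM.
- by move=> o; rewrite mulr_ge0.
- by move=> o; rewrite ler_wpM2l.
- under eq_integral do rewrite EFinM.
  rewrite ge0_integralZl //=; [|exact/measurable_EFinP|
    by move=> o _; rewrite lee_fin].
  by rewrite EFinM lee_wpmul2l.
Qed.

Lemma mean_le_sum (I : Type) (r : seq I) (Q : pred I) (X : I -> Om -> R)
    (v : I -> R) : (forall i, Q i -> mean_le (X i) (v i)) ->
  mean_le (fun o => \sum_(i <- r | Q i) X i o) (\sum_(i <- r | Q i) v i).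
Proof.
move=> h; elim: r => [|i r IH].
  rewrite big_nil; apply: mean_le_mono (mean_le_cst (lexx 0)) => o.
  by rewrite big_nil.
rewrite big_cons; case: ifP => Qi; last first.
  by apply: mean_le_mono IH => o; rewrite big_cons Qi.
apply: mean_le_mono (mean_leD (h i Qi) IH) => o.
by rewrite big_cons Qi.
Qed.

(** Here [c] stands for an L^2 norm, not a second moment, so that constants add under Minkowski's
    inequality. *)
Definition L2_le X (c : R) : Prop := mean_le (fun o => X o ^+ 2) (c ^+ 2).

Lemma L2_le_mono X Y c : (forall o, `|X o| <= `|Y o|) -> L2_le Y c -> L2_le X c.
Proof.
move=> XY; apply: mean_le_mono => o.
rewrite -[X o ^+ 2]real_normK ?num_real // -[Y o ^+ 2]real_normK ?num_real //.
by rewrite lerXn2r ?nnegrE.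
Qed.

Lemma L2_le_weak X c c' : 0 <= c -> c <= c' -> L2_le X c -> L2_le X c'.
Proof.
by move=> c0 cc'; apply: mean_le_weak; rewrite lerXn2r ?nnegrE // (le_trans c0).
Qed.

Lemma L2_le_ext X Y c : (forall o, X o = Y o) -> L2_le Y c -> L2_le X c.
Proof. by move=> e; apply: L2_le_mono => o; rewrite e. Qed.

Lemma L2_le_cst c a : `|a| <= c -> L2_le (fun=> a) c.
Proof.
move=> ac; have c0 : 0 <= c by apply: le_trans ac.
apply: mean_le_mono (mean_le_cst (sqr_ge0 c)) => o.
by rewrite -[a ^+ 2]real_normK ?num_real // lerXn2r ?nnegrE.
Qed.

Lemma L2_leZ a X c : L2_le X c -> L2_le (fun o => a * X o) (`|a| * c).
Proof.
move=> /(mean_leZ (sqr_ge0 a)); rewrite /L2_le exprMn.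
rewrite real_normK ?num_real //.
by apply: mean_le_mono => o; rewrite exprMn.
Qed.

Lemma L2_leN X c : L2_le X c -> L2_le (fun o => - X o) c.
Proof. by apply: L2_le_mono => o; rewrite normrN. Qed.

(* Minkowski's inequality, from
   (x + y)^2 <= (c + c') (x^2 / c + y^2 / c'). *)
Lemma L2_leD X Y c c' : 0 < c -> 0 < c' -> L2_le X c -> L2_le Y c' ->
  L2_le (fun o => X o + Y o) (c + c').
Proof.
move=> c0 c'0 hX hY.
have a0 : 0 <= (c + c') / c by rewrite divr_ge0 ?addr_ge0 ?ltW.
have b0 : 0 <= (c + c') / c' by rewrite divr_ge0 ?addr_ge0 ?ltW.
have := mean_leD (mean_leZ a0 hX) (mean_leZ b0 hY).
have -> : (c + c') / c * c ^+ 2 + (c + c') / c' * c' ^+ 2 = (c + c') ^+ 2.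
  by field; rewrite !gt_eqF.
apply: mean_le_mono => o; rewrite -subr_ge0.
have -> : (c + c') / c * X o ^+ 2 + (c + c') / c' * Y o ^+ 2 - (X o + Y o) ^+ 2
  = (c' * X o - c * Y o) ^+ 2 / (c * c').
  by field; rewrite !gt_eqF.
by rewrite divr_ge0 ?sqr_ge0 // mulr_ge0 ?ltW.
Qed.

(** Convexity of the square: a convex combination keeps the constant [c], where Minkowski's
    inequality with unrelated factors would enlarge it at each iteration. *)
Lemma L2_le_convex X Y a c : 0 <= a <= 1 -> L2_le X c -> L2_le Y c ->
  L2_le (fun o => a * X o + (1 - a) * Y o) c.
Proof.
move=> /andP[a0 a1] hX hY; have b0 : 0 <= 1 - a by rewrite subr_ge0.
have := mean_leD (mean_leZ a0 hX) (mean_leZ b0 hY).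
rewrite -mulrDl subrKC mul1r; apply: mean_le_mono => o; rewrite -subr_ge0.
have -> : a * X o ^+ 2 + (1 - a) * Y o ^+ 2 - (a * X o + (1 - a) * Y o) ^+ 2
  = a * (1 - a) * (X o - Y o) ^+ 2 by ring.
by apply: mulr_ge0; [exact: mulr_ge0|exact: sqr_ge0].
Qed.

Lemma L2_le_sum n (X : 'I_n -> Om -> R) c : 0 < c ->
  (forall i, L2_le (X i) c) -> L2_le (fun o => \sum_(i < n) X i o) (n%:R * c).
Proof.
move=> c0; elim: n X => [|n IH] X h.
  have h0 : L2_le (fun=> 0) 0 by apply: L2_le_cst; rewrite normr0.
  by rewrite mul0r; apply: L2_le_ext h0 => o; rewrite big_ord0.
apply: (@L2_le_ext _ (fun o => \sum_(i < n) X (widen_ord (leqnSn n) i) o +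
  X ord_max o)).
  by move=> o; rewrite big_ord_recr.
(* [L2_leD] wants positive constants and the empty sum has constant 0, so a single term is treated
   apart. *)
case: n IH X h => [|n] IH X h.
  by rewrite mul1r; apply: L2_le_ext (h ord_max) => o; rewrite big_ord0 add0r.
rewrite -natr1 mulrDl mul1r; apply: L2_leD => //.
- by rewrite mulr_gt0 ?ltr0Sn.
- exact: IH.
Qed.

(* The damping factor [l ^+ t] keeps [Z t] of order [min t (1 / (t (1 - l)))],
   hence of order [(1 - l)^(-1/2)], and keeps [(1 - l ^+ t) * Z t] of order 1;
   this is what prevents the losses of the three coupled recursions from
   multiplying. *)
Lemma L2_le_damped (Z e : nat -> Om -> R) (l s : R) :
  0 <= l < 1 -> 0 < s -> L2_le (Z 1%N) s ->
  (forall t, (0 < t)%N -> L2_le (e t) s) ->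
  (forall t o, (0 < t)%N -> Z t.+1 o = l ^+ t * (Z t o + e t o)) ->
  forall t, (0 < t)%N ->
    L2_le (Z t) (t%:R * s) /\ L2_le (Z t) (4 * s * (1 + (t%:R * (1 - l))^-1)).
Proof.
move=> /andP[l0 l1] s0 Z1 he hZ; set d := 1 - l.
have d0 : 0 < d by rewrite subr_gt0.
have lt_ge0 t : 0 <= l ^+ t by rewrite exprn_ge0.
have lt_le1 t : l ^+ t <= 1 by rewrite exprn_ile1 // ltW.
(* Bernoulli's inequality for [l = 1 - d]: one step lowers the product by
   [l ^+ t * (t + 1) * d ^+ 2]. *)
have lt_le t : l ^+ t * (1 + t%:R * d) <= 1.
  elim: t => [|t IH]; first by rewrite mul0r addr0 mulr1.
  have -> : l ^+ t.+1 * (1 + t.+1%:R * d) =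
    l ^+ t * (1 + t%:R * d) - l ^+ t * (t.+1%:R * d ^+ 2).
    by rewrite exprS -natr1 /d; ring.
  rewrite (le_trans _ IH) // lerBlDr lerDl.
  by apply: mulr_ge0 => //; apply: mulr_ge0; rewrite ?ler0n ?sqr_ge0.
have step t c : (0 < t)%N -> 0 < c -> L2_le (Z t) c ->
    L2_le (Z t.+1) (l ^+ t * (c + s)).
  move=> t0 c0 h; rewrite -[l ^+ t]ger0_norm //.
  by apply: L2_le_ext (L2_leZ _ (L2_leD c0 s0 h (he t t0))) => o; exact: hZ.
elim=> [//|t IH] _.
case: t IH => [|t] IH.
  rewrite mul1r; split => //; apply: L2_le_weak Z1; first exact: ltW.
  rewrite mulrDr mulr1; apply: ler_wpDr; last by lra.
  by rewrite mulr_ge0 ?invr_ge0 ?ltW ?mulr_gt0.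
have {IH} [h1 h2] := IH isT.
set u : R := t.+1%:R in h1 h2 *.
have u1 : 1 <= u by rewrite ler1n.
have u0 : 0 < u by apply: lt_le_trans u1.
have us : t.+2%:R = u + 1 by rewrite -natr1.
have hlu : l ^+ t.+1 * (1 + u * d) <= 1 by exact: lt_le.
rewrite us; clearbody u; clearbody d.
have k1 : L2_le (Z t.+2) ((u + 1) * s).
  have := step t.+1 (u * s) isT (mulr_gt0 u0 s0) h1.
  apply: L2_le_weak; first by rewrite mulr_ge0 ?lt_ge0 ?addr_ge0 ?mulr_ge0 ?ltW.
  rewrite -{2}(mul1r s) -mulrDl ler_piMl // mulr_ge0 ?ltW //.
  by rewrite addr_gt0.
split=> //.
have ud0 : 0 < u * d by rewrite mulr_gt0.
have u10 : 0 < u + 1 by rewrite addr_gt0.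
have u1d0 : 0 < (u + 1) * d by rewrite mulr_gt0.
(* In the first case damping by [l ^+ t.+1] propagates the bound [4 s (1 + 1/(u d))]; with [x = u d]
   and [y = (u + 1) d] the computation needs [4 d <= 3 x y], which is the threshold 4/3. In the
   second case [(u + 1)^2 d <= 2 u (u + 1) d < 4], so the linear bound [k1] is already good
   enough. *)
have [big|small] := leP (4 / 3) (u * (u + 1) * d).
  have c0 : 0 < 4 * s * (1 + (u * d)^-1).
    by rewrite !mulr_gt0 // addr_gt0 ?invr_gt0.
  have := step t.+1 _ isT c0 h2; apply: L2_le_weak.
    by rewrite mulr_ge0 ?lt_ge0 // addr_ge0 ?ltW.
  have hl : l ^+ t.+1 <= (1 + u * d)^-1.
    by rewrite -[leRHS]mul1r ler_pdivlMr // addr_gt0.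
  apply: (@le_trans _ _ ((1 + u * d)^-1 * (4 * s * (1 + (u * d)^-1) + s))).
    by rewrite ler_wpM2r // addr_ge0 ?ltW.
  rewrite -subr_ge0.
  have -> : 4 * s * (1 + ((u + 1) * d)^-1) -
      (1 + u * d)^-1 * (4 * s * (1 + (u * d)^-1) + s) =
      s * (4 * ((u + 1) * d + 1) * (u * d) * (1 + u * d) -
        (5 * (u * d) + 4) * ((u + 1) * d)) /
      (((u + 1) * d) * (u * d) * (1 + u * d)).
    by field; rewrite !gt_eqF // addr_gt0.
  have s0' := ltW s0; have x1 : 0 <= 1 + u * d by rewrite addr_ge0 // ltW.
  apply: divr_ge0; last by apply: mulr_ge0 => //; apply: mulr_ge0; exact: ltW.
  apply: mulr_ge0 => //.
  set x := u * d in ud0 *; set y := (u + 1) * d in u1d0 *.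
  have yx : y = x + d by rewrite /y mulrDl mul1r.
  have xy : 4 * d <= 3 * (x * y).
    have -> : x * y = u * (u + 1) * d * d by rewrite /x /y; ring.
    have := ler_wpM2r (ltW d0) big; lra.
  have x0 := ltW ud0; have y0 := ltW u1d0.
  have := mulr_ge0 x0 (mulr_ge0 x0 y0).
  have xxy : 0 <= x * (3 * (x * y) - 4 * d) by rewrite mulr_ge0 // subr_ge0.
  have xd : 0 <= x * d by rewrite mulr_ge0 // ltW.
  move: xy xxy; rewrite yx; nra.
apply: L2_le_weak k1; first by rewrite mulr_ge0 ?ltW ?addr_gt0.
rewrite mulrC -mulrA [leRHS]mulrCA ler_pM2l //.
apply: (@le_trans _ _ (4 * ((u + 1) * d)^-1)); last first.
  by rewrite ler_pM2l // lerDr.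
rewrite ler_pdivlMr // mulrA.
have : (u + 1) * d <= 2 * u * d by rewrite ler_pM2r //; lra.
move=> /(ler_wpM2l (ltW (addr_gt0 u0 ltr01))); nra.
Qed.

(** The inequality [1 - l ^+ t <= t (1 - l)] cancels the factor [1 / (t (1 - l))], which gives the
    first bound; it serves for the increments. The second bound is uniform in [t] and serves for the
    dispersion. *)
Lemma L2_le_damped_weighted (Z e : nat -> Om -> R) (l s : R) :
  0 <= l < 1 -> 0 < s -> L2_le (Z 1%N) s ->
  (forall t, (0 < t)%N -> L2_le (e t) s) ->
  (forall t o, (0 < t)%N -> Z t.+1 o = l ^+ t * (Z t o + e t o)) ->
  forall t, (0 < t)%N -> L2_le (fun o => (1 - l ^+ t) * Z t o) (8 * s) /\
    L2_le (Z t) (Num.sqrt (64 * s ^+ 2 / (1 - l))).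
Proof.
move=> l01 s0 Z1 he hZ t t0.
have [h1 h2] := L2_le_damped l01 s0 Z1 he hZ t0.
move: l01 => /andP[l0 l1]; set d := 1 - l.
have d0 : 0 < d by rewrite subr_gt0.
have u1 : 1 <= t%:R :> R by rewrite ler1n.
have u0 : 0 < t%:R :> R by apply: lt_le_trans u1.
have lt_ge : 1 - l ^+ t <= t%:R * d.
  clear -l0 l1 d0; elim: t => [|t IH]; first by rewrite mul0r subrr.
  have -> : 1 - l ^+ t.+1 = 1 - l ^+ t + l ^+ t * d by rewrite exprS /d; ring.
  rewrite -natr1 mulrDl mul1r lerD // ler_piMl ?(ltW d0) //.
  by rewrite exprn_ile1 // ltW.
have lt0 : 0 <= 1 - l ^+ t by rewrite subr_ge0 exprn_ile1 // ltW.
have ltl : 1 - l ^+ t <= 1 by rewrite gerBl exprn_ge0.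
have td0 : 0 < t%:R * d by rewrite mulr_gt0.
split.
  have := L2_leZ (1 - l ^+ t) h2; rewrite ger0_norm //.
  apply: L2_le_weak.
    apply: mulr_ge0 => //; rewrite ltW // mulr_gt0 ?mulr_gt0 //.
    by rewrite addr_gt0 ?invr_gt0.
  rewrite mulrCA -/d mulrDr mulr1.
  have : (1 - l ^+ t) * (t%:R * d)^-1 <= 1 by rewrite ler_pdivrMr ?mul1r.
  move=> h; have : (1 - l ^+ t) + (1 - l ^+ t) * (t%:R * d)^-1 <= 2 by lra.
  by move=> /(ler_wpM2l (mulr_ge0 (ler0n R 4) (ltW s0))); lra.
have d1 : d <= 1 by rewrite gerBl.
have v0 : 0 <= 64 * s ^+ 2 / d.
  by apply: divr_ge0; [apply: mulr_ge0 => //; exact: sqr_ge0|exact: ltW].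
rewrite /L2_le sqr_sqrtr //.
have t0' := ltW u0; have s0' := ltW s0; have d0' := ltW d0.
(* Three regimes. If [t d >= 1] the second bound is at most [8 s]; if [t^2 d <= 1] the linear bound
   gives [t s <= s / sqrt d]; in between, [1 / (t d)] is at least 1 and at most [1 / sqrt d]. *)
have [td|td] := leP 1 (t%:R * d).
  apply: mean_le_weak h2; apply: (@le_trans _ _ ((8 * s) ^+ 2)).
    have hx : (t%:R * d)^-1 <= 1 by rewrite invf_le1.
    have hx0 : 0 <= (t%:R * d)^-1 by rewrite invr_ge0 ltW.
    rewrite lerXn2r ?nnegrE ?mulr_ge0 ?addr_ge0 //.
    have := ler_wpM2l s0' hx; lra.
  rewrite ler_pdivlMr // exprMn -natrX.
  by rewrite ler_piMr // mulr_ge0 // sqr_ge0.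
have [ttd|ttd] := leP (t%:R ^+ 2 * d) 1.
  apply: mean_le_weak h1; rewrite ler_pdivlMr // exprMn mulrAC.
  by have := ler_wpM2r (sqr_ge0 s) ttd; have := sqr_ge0 s; lra.
apply: mean_le_weak h2; set x := (t%:R * d)^-1.
have x1 : 1 <= x by rewrite invf_ge1 // ltW.
have hx : d * x ^+ 2 <= 1.
  rewrite /x exprVn ler_pdivrMr ?exprn_gt0 // mul1r exprMn expr2 mulrA.
  by rewrite ler_peMl // ltW.
apply: (@le_trans _ _ (64 * s ^+ 2 * x ^+ 2)).
  have -> : 64 * s ^+ 2 * x ^+ 2 = (8 * s * x) ^+ 2 by ring.
  have x0 : 0 <= x by apply: le_trans x1.
  rewrite lerXn2r ?nnegrE ?mulr_ge0 ?addr_ge0 //.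
  have := ler_wpM2l s0' x1; lra.
rewrite ler_pdivlMr //.
have -> : 64 * s ^+ 2 * x ^+ 2 * d = 64 * s ^+ 2 * (d * x ^+ 2) by ring.
rewrite ler_piMr //.
by apply: mulr_ge0 => //; exact: sqr_ge0.
Qed.

End upper_mean.

(** * Gaussian and uniform moments *)

Section moments.
Context {R : realType}.

(** The Radon-Nikodym derivative agrees almost everywhere with the density, since both integrate to
    the same measure on every measurable set. *)
Lemma ge0_integral_normal_prob (m s : R) (f : R -> \bar R) :
  measurable_fun setT f -> (forall x, 0 <= f x)%E ->
  (\int[normal_prob m s]_x f x =
   \int[lebesgue_measure]_x (f x * (normal_pdf m s x)%:E))%E.
Proof.
move=> mf f0; have dom := @normal_prob_dominates R m s.
rewrite -(Radon_Nikodym_SigmaFinite.change_of_variables dom) //.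
have mpdf : measurable_fun setT (EFin \o normal_pdf m s).
  apply/measurable_EFinP. exact: measurable_normal_pdf.
have fi := Radon_Nikodym_SigmaFinite.f_integrable dom.
apply: ae_eq_integral => //.
- by apply: emeasurable_funM => //; exact: measurable_int fi.
- exact: emeasurable_funM.
- apply: ae_eqe_mul2l; apply: integral_ae_eq => // E _ mE.
  by rewrite -Radon_Nikodym_SigmaFinite.f_integral.
Qed.

(* Absorbing [x^4] into a Gaussian of twice the deviation bounds the fourth
   moment without computing it. *)
Lemma normal_pdf_fourth_le (s x : R) : 0 < s ->
  x ^+ 4 * normal_pdf 0 s x <= 64 * s ^+ 4 * normal_pdf 0 (2 * s) x.
Proof.
move=> s0; have s20 : 0 < 2 * s by rewrite mulr_gt0.
rewrite !normal_pdfE ?gt_eqF // /normal_fun !subr0.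
have -> : normal_peak s = 2 * normal_peak (2 * s).
  rewrite /normal_peak.
  have -> : (2 * s) ^+ 2 * pi *+ 2 = 2 ^+ 2 * (s ^+ 2 * pi *+ 2) by ring.
  rewrite sqrtrM ?sqr_ge0 // sqrtr_sqr ger0_norm // invfM mulrA divff //.
  by rewrite mul1r.
(* The two Gaussian exponents differ by [y], as 1/2 - 1/8 = 3/8; thus [x^4] is a multiple of [y^2],
   which [4 * expR y] dominates. *)
set y := 3 / 8 * (x / s) ^+ 2.
have y0 : 0 <= y by rewrite mulr_ge0 ?sqr_ge0.
have hy : y ^+ 2 <= 4 * expR y.
  have h1 : 1 + y / 2 <= expR (y / 2) by exact: expR_ge1Dx.
  have e : expR y = expR (y / 2) ^+ 2.
    by rewrite expr2 -expRD -mulrDl -mulr2n -(mulr_natr y) mulfK.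
  rewrite e -subr_ge0.
  have -> : 4 * expR (y / 2) ^+ 2 - y ^+ 2 =
    (2 * expR (y / 2) - y) * (2 * expR (y / 2) + y) by ring.
  by rewrite mulr_ge0 //; lra.
have ex : expR (- x ^+ 2 / ((2 * s) ^+ 2 *+ 2)) =
    expR y * expR (- x ^+ 2 / (s ^+ 2 *+ 2)).
  rewrite -expRD; congr expR; rewrite /y.
  by field; rewrite gt_eqF.
have x4 : x ^+ 4 = 64 / 9 * s ^+ 4 * y ^+ 2.
  by rewrite /y; field; rewrite gt_eqF.
rewrite ex x4; set E := expR (- _ / _).
have E0 : 0 <= E by exact: expR_ge0.
set k := normal_peak _; have k0 : 0 <= k by exact: normal_peak_ge0.
have -> : 64 / 9 * s ^+ 4 * y ^+ 2 * (2 * k * E) =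
  (128 / 9 * s ^+ 4 * k * E) * y ^+ 2 by ring.
have -> : 64 * s ^+ 4 * (k * (expR y * E)) =
  (16 * s ^+ 4 * k * E) * (4 * expR y) by ring.
have c0 : 0 <= s ^+ 4 * k * E.
  by apply: mulr_ge0 => //; apply: mulr_ge0 => //; rewrite exprn_ge0 // ltW.
apply: ler_pM; rewrite ?sqr_ge0 //; lra.
Qed.

Lemma normal_fourth_moment (s : R) : 0 < s ->
  (\int[normal_prob 0 s]_x (x ^+ 4)%:E <= (64 * s ^+ 4)%:E)%E.
Proof.
move=> s0.
have m4 : measurable_fun setT (fun x : R => x ^+ 4) by exact: measurable_funX.
have x4 (x : R) : 0 <= x ^+ 4 by rewrite -[4%N]/(2 * 2)%N exprM sqr_ge0.
rewrite ge0_integral_normal_prob; [|exact/measurable_EFinP|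
  by move=> x; rewrite lee_fin].
apply: (@le_trans _ _ (\int[lebesgue_measure]_x
    ((64 * s ^+ 4)%:E * (normal_pdf 0 (2 * s) x)%:E))%E).
  apply: ge0_le_integral => //.
  - by move=> x _; rewrite mule_ge0 // lee_fin // normal_pdf_ge0.
  - apply: emeasurable_funM; apply/measurable_EFinP => //.
    exact: measurable_normal_pdf.
  - apply: emeasurable_funM; apply/measurable_EFinP => //.
    exact: measurable_normal_pdf.
  - by move=> x _; rewrite -!EFinM lee_fin normal_pdf_fourth_le.
rewrite ge0_integralZl //.
- by rewrite integral_normal_pdf mule1.
- by apply/measurable_EFinP; exact: measurable_normal_pdf.
- by move=> x _; rewrite lee_fin normal_pdf_ge0.
- by rewrite lee_fin mulr_ge0 // exprn_ge0 // ltW.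
Qed.

Context {dO : measure_display} {Om : measurableType dO}.
Context (P : probability Om R).

Lemma ge0_integral_law d' (T : measurableType d') (X : Om -> T)
    (nu : {measure set T -> \bar R}) (f : T -> \bar R) :
  measurable_fun setT X ->
  (forall B : set T, measurable B -> P (X @^-1` B) = nu B) ->
  measurable_fun setT f -> (forall x, 0 <= f x)%E ->
  (\int[P]_o f (X o) = \int[nu]_x f x)%E.
Proof.
move=> mX hX mf f0.
have := ge0_integral_pushforward mX P measurableT mf (fun x _ => f0 x).
rewrite preimage_setT => <-.
by apply: eq_measure_integral => B mB _; rewrite -hX.
Qed.

Lemma measurable_coord d (X : Om -> 'rV[R]_d) (j : 'I_d) :
  random_vector X -> measurable_fun setT (fun o => X o 0 j).
Proof.
move=> rX; apply: (measurability _ (RGenOpens.measurableE R)).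
move=> _ [_ [a [b ->]] <-]; rewrite setTI.
apply: (rX [set x : 'rV[R]_d | `]a, b[%classic (x 0 j)]).
apply: sub_sigma_algebra; apply: open_comp; last exact: interval_open.
by move=> x _; exact: coord_continuous.
Qed.

(** The coordinate is the projection on [delta_mx 0 j], hence centered normal of variance [M j j].
    Zero variance is a separate case, where the law is a Dirac mass. *)
Lemma gaussian_fourth_moment d (M : 'M[R]_d) (X : Om -> 'rV[R]_d) (j : 'I_d) :
  0 <= M j j -> gaussian_vector P M X ->
  mean_le P (fun o => X o 0 j ^+ 4) (64 * M j j ^+ 2).
Proof.
move=> M0 [rX hX]; have mX := measurable_coord j rX.
have x4 (x : R) : 0 <= x ^+ 4 by rewrite -[4%N]/(2 * 2)%N exprM sqr_ge0.
have m4 : measurable_fun setT (fun x : R => x ^+ 4) by exact: measurable_funX.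
have eX o : (X o *m (delta_mx 0 j)^T) 0 0 = X o 0 j.
  rewrite mxE (bigD1 j) //= !mxE !eqxx mulr1 big1 ?addr0 // => k kj.
  by rewrite !mxE (negbTE kj) andbF mulr0.
have eM : qform M (delta_mx 0 j) = M j j.
  by rewrite /qform -rowE trmx_delta -colE !mxE.
have law B : measurable B -> P ((fun o => X o 0 j) @^-1` B) =
    centered_normal (M j j) B.
  move=> mB; rewrite -eM -hX //; congr (P _).
  by apply/seteqP; split=> o /=; rewrite eX.
exists (fun o => X o 0 j ^+ 4); split => //.
  by apply: measurable_funX.
have [Mj0|Mj0] := eqVneq (M j j) 0.
  rewrite (@ge0_integral_law _ R _ (\d_(0 : R)) (fun x => (x ^+ 4)%:E) mX) //.
  - rewrite integral_dirac //; last exact/measurable_EFinP.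
    by rewrite diracT mul1e expr0n Mj0 expr0n mulr0.
  - by move=> B mB; rewrite law // /centered_normal Mj0 eqxx.
  - exact/measurable_EFinP.
have s0 : 0 < Num.sqrt (M j j) by rewrite sqrtr_gt0 lt_def Mj0.
rewrite (@ge0_integral_law _ (measurableTypeR R) _ (normal_prob 0 (Num.sqrt (M j j)))
  (fun x => (x ^+ 4)%:E) mX) //.
- apply: le_trans (normal_fourth_moment s0) _.
  by rewrite -[4%N]/(2 * 2)%N exprM sqr_sqrtr.
- by move=> B mB; rewrite law // /centered_normal (negbTE Mj0).
- exact/measurable_EFinP.
Qed.

(** The tail of [- ln u] at [r >= 0] is at most [expR (- r)], the exponential density of rate 1;
    integrating the tail gives total mass 1. The maximum with 0 keeps the variable nonnegative at
    every outcome, also where [u] exceeds 1. *)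
Lemma uniform_log_moment (u : Om -> R) : uniform01_variable P u ->
  mean_le P (fun o => Num.max 0 (- ln (u o))) 1.
Proof.
move=> [mu hu]; pose X o : R := Num.max 0 (- ln (u o)).
have mX : measurable_fun setT X.
  apply: measurable_maxr => //; apply: measurableT_comp => //.
  by apply: measurableT_comp => //; exact: measurable_ln.
have X0 o : 0 <= X o by rewrite /X le_max lexx.
exists X; split => //.
pose mixX := isMeasurableFun.Build _ _ _ _ _ mX.
pose X' : {RV P >-> R} := HB.pack X mixX.
have -> : (\int[P]_o (X o)%:E)%E = ('E_P[X'])%E by rewrite unlock.
rewrite (@ge0_expectation_ccdf _ _ R P X' X0) -(@integral_exponential_pdf R 1) //.
rewrite integral_mkcond; apply: ge0_le_integralT => r.
  by apply: erestrict_ge0 => x _; exact: measure_ge0.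
rewrite patchE /exponential_pdf patchE; case: ifPn => // r0.
rewrite mul1r mulN1r /ccdf /distribution /pushforward /=.
have {}r0 : 0 <= r by move: r0; rewrite inE /= in_itv /= andbT.
apply: (@le_trans _ _ (P (u @^-1` `]-oo, expR (- r)]))).
  apply: le_measure; rewrite ?inE.
  - by rewrite -[X in measurable X]setTI; exact: (mX measurableT).
  - by rewrite -[X in measurable X]setTI; exact: (mu measurableT).
  move=> o /=; rewrite !in_itv /= andbT lt_max ltNge r0 /= => h.
  have [u0|u0] := leP (u o) 0; first by rewrite (le_trans u0) // expR_ge0.
  by rewrite -[u o]lnK ?posrE // ler_expR lerNr ltW.
rewrite hu // /uniform_prob integral_uniform_pdf.
have e0 := expR_gt0 (- r).
rewrite (_ : _ `&` _ = `[0, expR (- r)]%classic); last first.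
  have e1 : expR (- r) <= 1 by rewrite -expR0 ler_expR oppr_le0.
  apply/seteqP; split=> x /=; rewrite !in_itv /=.
    by move=> [-> /andP[-> _]].
  by move=> /andP[-> h]; rewrite h (le_trans h).
rewrite (eq_integral (fun=> 1%E)); last first.
  move=> x; rewrite inE /= in_itv /= /uniform_pdf => /andP[x0 xe].
  rewrite x0 (le_trans xe) ?subr0 ?invr1 //.
  by rewrite -expR0 ler_expR oppr_le0.
by rewrite integral_cst //= mul1e lebesgue_measure_itv /= lte_fin e0 oppr0 adde0.
Qed.

End moments.

(** * Matrix norms and derivatives *)

Section matrix_norms.
Context {R : realType}.

Lemma sum_sqr_ge0 m n (x : 'M[R]_(m, n)) : 0 <= \sum_i \sum_j x i j ^+ 2.
Proof. by apply: sumr_ge0 => i _; apply: sumr_ge0 => j _; exact: sqr_ge0. Qed.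

Lemma enorm_sqr m n (x : 'M[R]_(m, n)) :
  enorm x ^+ 2 = \sum_i \sum_j x i j ^+ 2.
Proof. by rewrite /enorm sqr_sqrtr // sum_sqr_ge0. Qed.

Lemma enorm_ge0 m n (x : 'M[R]_(m, n)) : 0 <= enorm x.
Proof. exact: sqrtr_ge0. Qed.

Lemma entry_le_enorm m n (x : 'M[R]_(m, n)) i j : `|x i j| <= enorm x.
Proof.
rewrite -(@ler_pXn2r _ 2) ?nnegrE ?enorm_ge0 // real_normK ?num_real //.
rewrite enorm_sqr (bigD1 i) //= (bigD1 j) //= -addrA lerDl addr_ge0 //.
  by apply: sumr_ge0 => k _; exact: sqr_ge0.
by apply: sumr_ge0 => k _; apply: sumr_ge0 => l _; exact: sqr_ge0.
Qed.

Lemma entry_le_opnorm n (B : 'M[R]_n) i j : `|B i j| <= opnorm B.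
Proof.
have e1 : enorm (delta_mx j 0 : 'cV[R]_n) <= 1.
  rewrite -(@ler_pXn2r _ 2) ?nnegrE ?enorm_ge0 // enorm_sqr expr1n.
  rewrite (bigD1 j) //= big_ord1 mxE !eqxx expr1n big1 ?addr0 // => k kj.
  by rewrite big_ord1 mxE (negbTE kj) expr0n.
apply: (@le_trans _ _ (enorm (B *m (delta_mx j 0 : 'cV_n)))).
  by rewrite -colE; have := entry_le_enorm (col j B) i 0; rewrite mxE.
apply: ub_le_sup; last by exists (delta_mx j 0).
(* A supremum dominates its members only when the set is bounded. Entries of a vector in the unit
   ball are at most 1, so absolute row sums bound the entries of [B *m x]. *)
exists (Num.sqrt (\sum_(k < n) \sum_(l < 1) (\sum_l `|B k l|) ^+ 2)).
move=> _ [x /= x1 <-]; rewrite ler_wsqrtr //.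
apply: ler_sum => k _; apply: ler_sum => l _.
rewrite -[leLHS]real_normK ?num_real // lerXn2r ?nnegrE ?sumr_ge0 //.
rewrite mxE (le_trans (ler_norm_sum _ _ _)) //; apply: ler_sum => a _.
by rewrite normrM ler_piMr // (le_trans (entry_le_enorm _ _ _)).
Qed.

Lemma qform_le n (B : 'M[R]_n) (x : 'rV[R]_n) c :
  (forall i j, `|B i j| <= c) ->
  `|qform B x| <= c * n%:R * \sum_j x 0 j ^+ 2.
Proof.
move=> hB; have qE : qform B x = \sum_j \sum_i x 0 i * B i j * x 0 j.
  by rewrite /qform mxE; apply: eq_bigr => j _; rewrite !mxE mulr_suml.
rewrite qE (le_trans (ler_norm_sum _ _ _)) //.
apply: (@le_trans _ _ (\sum_(j < n) \sum_(i < n)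
    c * (2^-1 * (x 0 i ^+ 2 + x 0 j ^+ 2)))).
  apply: ler_sum => j _; rewrite (le_trans (ler_norm_sum _ _ _)) //.
  apply: ler_sum => i _; rewrite !normrM mulrAC mulrC ler_pM ?mulr_ge0 //.
  have := sqr_ge0 (`|x 0 i| - `|x 0 j|).
  rewrite sqrrB !real_normK ?num_real //; lra.
under eq_bigr do rewrite -mulr_sumr -mulr_sumr big_split /= sumr_const card_ord.
rewrite -mulr_sumr -mulr_sumr big_split /= sumr_const card_ord -sumrMnl.
rewrite -mulrA le_eqVlt; apply/orP; left; apply/eqP; congr (c * _).
by rewrite sumrMnl -mulr_natl; field.
Qed.

End matrix_norms.

Section derivatives.
Context {R : realType} {d : nat}.
Implicit Types (h : 'rV[R]_d -> R) (x y : 'rV[R]_d).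

Lemma gradN h x : differentiable h x -> grad (fun z => - h z) x = - grad h x.
Proof.
move=> hx; apply/rowP => j; rewrite !mxE deriveN //; exact: diff_derivable.
Qed.

Lemma jacobianE n (G : 'rV[R]_d -> 'rV[R]_n) x i j : differentiable G x ->
  jacobian G x i j = 'D_(delta_mx 0 i) G x 0 j.
Proof. by move=> hG; rewrite deriveE // mxE. Qed.

Lemma hess_potential m (f : 'I_m -> 'rV[R]_d -> R) i x :
  twice_differentiable (f i) -> hess (potential f i) x = - hess (f i) x.
Proof.
move=> [h1 h2]; have e : grad (potential f i) = - grad (f i).
  by apply/funext => z; rewrite gradN.
apply/matrixP => k l.
have h3 : differentiable (- grad (f i)) x by exact: differentiableN.
rewrite [RHS]mxE /hess e [LHS]jacobianE //.
rewrite deriveN; last exact: diff_derivable.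
by rewrite [LHS]mxE jacobianE.
Qed.

Lemma derive_grad h x v j : differentiable (grad h) x ->
  is_derive x v (fun z => grad h z 0 j) ((v *m hess h x) 0 j).
Proof.
move=> hx; have dx : derivable (grad h) x v by exact: diff_derivable.
apply: DeriveDef; first by have /derivable_mxP := dx; apply.
have := congr1 (fun N : 'rV[R]_d => N 0 j) (derive_mx dx).
by rewrite [X in _ = X -> _]mxE => <-; rewrite deriveE // mul_rV_lin1.
Qed.

(** Mean value theorem on the segment from [y] to [x], applied to one coordinate of the gradient at
    a time, so that its scalar form suffices. *)
Lemma grad_lipschitz h c : (forall x, differentiable (grad h) x) ->
  (forall x i j, `|hess h x i j| <= c) ->
  forall x y j, `|grad h x 0 j - grad h y 0 j| <= c * \sum_l `|x 0 l - y 0 l|.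
Proof.
move=> hd hc x y j; set v := x - y.
pose phi (s : R) := grad h (y + s *: v) 0 j.
have dphi (s : R) : is_derive s 1 phi ((v *m hess h (y + s *: v)) 0 j).
  have [D1 D2] := @derive_grad h (y + s *: v) v j (hd _).
  have e : (fun a => a^-1 *: ((phi \o shift s) (a *: 1) - phi s)) =
      (fun a => a^-1 *: (((fun z => grad h z 0 j) \o shift (y + s *: v)) (a *: v)
         - grad h (y + s *: v) 0 j)).
    apply/funext => a; rewrite /phi /= [a *: 1](mulr1 a).
    by rewrite scalerDl addrCA.
  by split; [rewrite /derivable e|rewrite /derive e].
have [s _] := @MVT R phi _ 0 1 ltr01 (fun s _ => dphi s)
  (derivable_within_continuous (fun s _ => @ex_derive _ _ _ _ _ _ _ (dphi s))).
rewrite /phi scale1r scale0r addr0 /v subrKC subr0 mulr1 -/v => ->.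
rewrite mxE (le_trans (ler_norm_sum _ _ _)) // mulr_sumr ler_sum // => l _.
rewrite normrM mulrC [v 0 l]mxE [(- y) 0 l]mxE.
by apply: ler_wpM2r => //; exact: hc.
Qed.

End derivatives.

(** * Eigenbasis of the gossip matrix *)

Section gossip.
Context {R : realType} {m : nat}.

(** An orthonormal eigenbasis, stored as rows in the order of [lam]. The last clause is
    orthogonality to the constant vector: row 0 carries the mean, the other rows the deviation from
    consensus. *)
Definition gossip_basis (A : 'M[R]_m) (lam : m.-tuple R) (Q : 'M[R]_m) : Prop :=
  [/\ Q *m Q^T = 1%:M,
      forall t, Q *m A ^+ t = diag_mx (\row_k lam`_k ^+ t) *m Q &
      forall k : 'I_m, (0 < k)%N -> \sum_i Q k i = 0].

Lemma gossip_eigenvalue_bounds (E : rel 'I_m) (A : 'M[R]_m) (lam : m.-tuple R)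
    (k : 'I_m) :
  gossip_matrix E A lam -> (0 < k)%N -> 0 <= lam`_k <= lam`_1.
Proof.
move=> [_ _ _ [_ slam] [_ _ lam0]] k0.
have hk : (k < size lam)%N by rewrite size_tuple.
have := lam0 k; rewrite (tnth_nth 0) => -> /=.
apply: (sorted_leq_nth _ _ 0 slam) => //.
- by move=> x y z /= yx xz; exact: le_trans xz yx.
- by move=> x /=; exact: lexx.
- by rewrite inE (leq_ltn_trans k0).
Qed.

Lemma gossip_basis_exists (E : rel 'I_m) (A : 'M[R]_m) (lam : m.-tuple R) :
  gossip_matrix E A lam -> exists Q, gossip_basis A lam Q.
Proof.
move=> hg; have [_ [AT [_ A1 _]] _ [chA _] [_ lam1 _]] := hg.
have [Q [QQ QA]] := symmetric_spectral AT chA.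
exists Q; split=> //.
  elim=> [|t IH].
    rewrite expr0 mulmx1; have -> : \row_k lam`_k ^+ 0 = const_mx 1 :> 'rV[R]_m.
      by apply/rowP => k; rewrite !mxE.
    by rewrite diag_const_mx mul1mx.
  rewrite exprS mulmxA QA -mulmxA IH mulmxA; congr (_ *m _).
  by rewrite mulmx_diag; congr diag_mx; apply/rowP => k; rewrite !mxE exprS.
move=> k k0; have /andP[_ hk] := gossip_eigenvalue_bounds hg k0.
(* [A] fixes the constant vector, so the sum of row [k] equals [lam]_k[times itself, and]lam[_k < 1]
   forces it to vanish. *)
have e : \sum_i Q k i = lam`_k * \sum_i Q k i.
  have := congr1 (fun M : 'M[R]_m => (M *m (const_mx 1 : 'cV[R]_m)) k 0) QA.
  have -> : Q *m A *m const_mx 1 = Q *m const_mx 1 :> 'cV[R]_m.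
    rewrite -mulmxA; congr (_ *m _); apply/colP => i.
    by rewrite !mxE -[RHS](A1 i); apply: eq_bigr => j _; rewrite mxE mulr1.
  rewrite -mulmxA mul_diag_mx !mxE.
  by under eq_bigr do rewrite mxE mulr1.
have : (1 - lam`_k) * \sum_i Q k i = 0 by rewrite mulrBl mul1r -e subrr.
move=> /eqP; rewrite mulf_eq0 subr_eq0 => /orP[/eqP h|/eqP //].
by move: (le_lt_trans hk lam1); rewrite -h ltxx.
Qed.

Lemma enorm_orthogonal n (Q : 'M[R]_m) (x : 'M[R]_(m, n)) :
  Q *m Q^T = 1%:M -> enorm (Q *m x) ^+ 2 = enorm x ^+ 2.
Proof.
move=> QQ; have tr n1 n2 (y : 'M[R]_(n1, n2)) : enorm y ^+ 2 = \tr (y^T *m y).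
  rewrite enorm_sqr exchange_big /mxtrace /=; apply: eq_bigr => j _.
  by rewrite mxE; apply: eq_bigr => i _; rewrite mxE expr2.
by rewrite !tr trmx_mul -mulmxA [Q^T *m _]mulmxA (mulmx1C QQ) mul1mx.
Qed.

(** Parseval's identity in the basis [Q]: centering kills the component along the constant vector
    and only changes the sign of the others. *)
Lemma consensus_error n (A : 'M[R]_m) (lam : m.-tuple R) (Q : 'M[R]_m)
    (x : 'M[R]_(m, n)) : gossip_basis A lam Q ->
  enorm (average x - x) ^+ 2 =
  \sum_(k < m | (0 < k)%N) \sum_j (Q *m x) k j ^+ 2.
Proof.
move=> [QQ _ Q0].
rewrite -(enorm_orthogonal _ QQ) enorm_sqr (bigID (fun k : 'I_m => (0 < k)%N)) /=.
rewrite [X in _ + X]big1 ?addr0; last first.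
  move=> k k0; apply: big1 => j _.
  have m0 : (m%:R : R) != 0 by rewrite pnatr_eq0 -lt0n (leq_trans _ (ltn_ord k)).
  (* Here [k] is 0. Applying [Q^T *m Q = 1] to the constant vector, all other rows contribute
     nothing, so [Q k i] times the sum of row [k] is 1 for every [i]: the row is constant. *)
  have [c hc] : exists c, forall i, Q k i = c.
    exists (\sum_i Q k i)^-1 => i.
    have h : Q k i * \sum_j Q k j = 1.
      have := congr1 (fun M : 'M[R]_m => (M *m (const_mx 1 : 'cV[R]_m)) i 0)
        (mulmx1C QQ).
      rewrite -mulmxA mul1mx !mxE => <-; rewrite [RHS](bigD1 k) //= [X in _ = _ + X]big1.
        rewrite !mxE addr0; congr (_ * _); apply: eq_bigr => l _.
        by rewrite mxE mulr1.
      move=> l lk; rewrite !mxE; under eq_bigr do rewrite mxE mulr1.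
      rewrite Q0 ?mulr0 //; move: k0 lk; rewrite -leqNgt leqn0 => /eqP k0.
      by rewrite -val_eqE /= k0 lt0n.
    have s0 : \sum_j Q k j != 0.
      by apply: contraTneq (oner_neq0 R) => s0; rewrite -h s0 mulr0 eqxx.
    by rewrite -[RHS]mul1r -h mulfK.
  rewrite mxE (eq_bigr (fun i => c * (average x - x) i j)); last first.
    by move=> i _; rewrite hc.
  rewrite -mulr_sumr; under eq_bigr do rewrite !mxE.
  rewrite sumrB sumr_const card_ord -[(_ * _) *+ m]mulr_natl mulrA mulfV //.
  rewrite mul1r subrr mulr0.
  by rewrite expr0n.
apply: eq_bigr => k k0; apply: eq_bigr => j _.
rewrite mulmxBr mxE [X in X + _]mxE.
under eq_bigr do rewrite mxE.
by rewrite -mulr_suml Q0 // mul0r add0r mxE sqrrN.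
Qed.

Lemma orthogonal_entry_le1 (Q : 'M[R]_m) i j : Q *m Q^T = 1%:M -> `|Q i j| <= 1.
Proof.
move=> QQ; rewrite -(@ler_pXn2r _ 2) ?nnegrE // expr1n real_normK ?num_real //.
have := congr1 (fun M : 'M[R]_m => M i i) QQ; rewrite !mxE eqxx mulr1n => <-.
rewrite (bigD1 j) //= mxE expr2 lerDl sumr_ge0 // => k _.
by rewrite mxE -expr2 sqr_ge0.
Qed.

End gossip.

(** * Moment bounds along the algorithm *)

(* If the proposal is accepted then
   [eps^2 |g|^2 <= - eps^2 a - 2 ln x]: the displacement is controlled although
   [g] itself is not bounded. *)
Lemma accepted_step_sqr_le (R : realType) d (eps : R) (p g : 'rV[R]_d) (a x : R)
    (j : 'I_d) : 0 < eps ->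
  ln x <= Num.min 0 (- (2^-1 * eps ^+ 2 * (a + enorm g ^+ 2))) ->
  (eps *: (p + eps *: g)) 0 j ^+ 2 <= 2 * eps ^+ 2 * p 0 j ^+ 2 +
    eps ^+ 4 * (1 + a ^+ 2) + 4 * eps ^+ 2 * Num.max 0 (- ln x).
Proof.
move=> e0; rewrite le_min => /andP[x0 hx].
have -> : Num.max 0 (- ln x) = - ln x by apply/max_idPr; rewrite oppr_ge0.
rewrite !mxE; have e2 : 0 < eps ^+ 2 by rewrite exprn_gt0.
have hg : g 0 j ^+ 2 <= enorm g ^+ 2.
  rewrite -[leLHS]real_normK ?num_real // lerXn2r ?nnegrE ?enorm_ge0 //.
  exact: entry_le_enorm.
have hgl : eps ^+ 2 * g 0 j ^+ 2 <= - eps ^+ 2 * a - 2 * ln x.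
  have := ler_wpM2l (ltW e2) hg; lra.
have ha : - a <= 2^-1 * (1 + a ^+ 2) by have := sqr_ge0 (a + 1); lra.
have h1 : eps ^+ 2 * g 0 j ^+ 2 <= eps ^+ 2 * (2^-1 * (1 + a ^+ 2)) - 2 * ln x.
  have := ler_wpM2l (ltW e2) ha; lra.
have h2 := ler_wpM2l (ltW e2) h1.
have h3 : 0 <= eps ^+ 2 * (p 0 j - eps * g 0 j) ^+ 2.
  by rewrite mulr_ge0 ?sqr_ge0 // ltW.
have -> : eps ^+ 4 = eps ^+ 2 * eps ^+ 2 by ring.
lra.
Qed.

(* Along the algorithm every quantity has L^2 norm at most a constant times
   [opnorm M]; these are the constants.  Since [kappa <= opnorm M], bounds that
   do not scale with [M] (initial values, acceptance variables) are absorbed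
   through powers of [kappa^-1]. *)
Section constants.
Context {R : realType} (m d : nat) (L eps kappa b : R).

Definition init_bound := b / kappa.
Definition noise_bound := 8 + kappa^-1.
Definition hess_bound := L * d%:R * (d%:R * 8).
Definition aleph_gap_bound := m%:R * (init_bound + hess_bound).
Definition aleph_bound := aleph_gap_bound + m%:R * hess_bound.
Definition step_bound :=
  1 + (2 * eps ^+ 2 * noise_bound ^+ 2
       + eps ^+ 4 * (kappa ^- 2 + (m%:R * aleph_bound) ^+ 2)
       + 4 * eps ^+ 2 * kappa ^- 2).
Definition pos_bound := m%:R * (step_bound + init_bound).
Definition incr_bound := m%:R * (9 * pos_bound) + 2 * init_bound.
Definition grad_bound := m%:R * (L * (d%:R * incr_bound) + init_bound).
Definition total_bound :=
  64 * m%:R * d%:R * (pos_bound ^+ 2 + grad_bound ^+ 2) +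
  m%:R * aleph_bound ^+ 2.

Context (m0 : (0 < m)%N) (d0 : (0 < d)%N) (L0 : 0 < L) (eps0 : 0 < eps).
Context (kappa0 : 0 < kappa) (b0 : 0 < b).

Lemma bounds_gt0 :
  [/\ 0 < init_bound, 0 < noise_bound, 0 < hess_bound, 0 < aleph_gap_bound &
   [/\ 0 < aleph_bound, 0 < step_bound, 0 < pos_bound, 0 < incr_bound &
     0 < grad_bound]].
Proof.
have m0' : 0 < m%:R :> R by rewrite ltr0n.
have d0' : 0 < d%:R :> R by rewrite ltr0n.
have h1 : 0 < init_bound by rewrite divr_gt0.
have h2 : 0 < noise_bound by rewrite addr_gt0 // invr_gt0.
have h3 : 0 < hess_bound by rewrite /hess_bound mulr_gt0 // mulr_gt0.
have h4 : 0 < aleph_gap_bound by rewrite mulr_gt0 // addr_gt0.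
have h5 : 0 < aleph_bound by rewrite addr_gt0 // mulr_gt0.
have h6 : 0 < step_bound.
  have k2 : 0 <= kappa ^- 2 by rewrite invr_ge0 exprn_ge0 // ltW.
  have e2 := ltW (exprn_gt0 2 eps0); have e4 := ltW (exprn_gt0 4 eps0).
  rewrite ltr_wpDr // addr_ge0 ?addr_ge0 //; last by rewrite mulr_ge0 // mulr_ge0.
    by apply: mulr_ge0; [rewrite mulr_ge0|exact: sqr_ge0].
  by apply: mulr_ge0 => //; rewrite addr_ge0 // sqr_ge0.
have h7 : 0 < pos_bound by rewrite mulr_gt0 // addr_gt0.
have h8 : 0 < incr_bound by rewrite addr_gt0 // mulr_gt0 // mulr_gt0.
have h9 : 0 < grad_bound by rewrite mulr_gt0 // addr_gt0 // mulr_gt0 // mulr_gt0.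
by [].
Qed.
End constants.

Section mixing.
Context {R : realType} {dO : measure_display} {Om : measurableType dO}.
Context (P : probability Om R).

Lemma L2_le_mulmx m n (Q : 'M[R]_m) (X : Om -> 'M[R]_(m, n)) c :
  (forall i k, `|Q i k| <= 1) -> 0 < c ->
  (forall i j, L2_le P (fun o => X o i j) c) ->
  forall i j, L2_le P (fun o => (Q *m X o) i j) (m%:R * c).
Proof.
move=> hQ c0 hX i j.
apply: (@L2_le_ext _ _ _ _ _ (fun o => \sum_(k < m) Q i k * X o k j)).
  by move=> o; rewrite mxE.
apply: (L2_le_sum (X := fun k o => Q i k * X o k j)) => // k.
apply: L2_le_mono (hX k j) => o.
by rewrite normrM ler_piMl.
Qed.

Lemma L2_le_scale a X c : 0 <= a -> L2_le P X c ->
  L2_le P (fun o => a * X o) (a * c).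
Proof. by move=> a0 /(L2_leZ a); rewrite ger0_norm. Qed.

End mixing.

Section process.
Context {R : realType} {m d : nat} {dO : measure_display}
  {Om : measurableType dO}.
Context (P : probability Om R) (L eps kappa b beta : R).
Context (f : 'I_m -> 'rV[R]_d -> R) (A : 'M[R]_m) (lam : m.-tuple R)
  (Q : 'M[R]_m) (M : 'M[R]_d) (w0 w1 g1 : 'M[R]_(m, d)) (al1 : 'cV[R]_m)
  (p : nat -> 'I_m -> Om -> 'rV[R]_d) (u : nat -> 'I_m -> Om -> R)
  (w g : nat -> Om -> 'M[R]_(m, d)) (al : nat -> Om -> 'cV[R]_m).

Context (m_gt0 : (0 < m)%N) (d_gt0 : (0 < d)%N).
Context (L0 : 0 < L) (eps0 : 0 < eps) (kappa0 : 0 < kappa) (b0 : 0 < b).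
Context (hf : forall i, twice_differentiable (f i)).
Context (hL : forall i x k l, `|hess (f i) x k l| <= L).
Context (hQ : gossip_basis A lam Q).
Context (hlam : forall k : 'I_m, 0 <= lam`_k <= 1).
Context (hlam0 : lam`_0 = 1).
Context (hbeta : forall k : 'I_m, (0 < k)%N -> lam`_k <= beta).
Context (beta1 : beta < 1).
Context (hM : covariance_matrix M).
Context (hkappa : kappa <= opnorm M).
Context (hp : forall t i, gaussian_vector P M (p t i)).
Context (hu : forall t i, uniform01_variable P (u t i)).
Context (hw0 : forall i j, `|w0 i j| <= b).
Context (hw1 : forall i j, `|w1 i j| <= b).
Context (hg1 : forall i j, `|g1 i j| <= b).
Context (hal1 : forall i j, `|al1 i j| <= b).
Context (hrun : decentralized_mala f A eps p u w0 w1 g1 al1 w g al).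

Local Notation mu := (opnorm M).
Local Notation initB := (init_bound kappa b).
Local Notation noiseB := (noise_bound kappa).
Local Notation hessB := (hess_bound d L).
Local Notation gapB := (aleph_gap_bound m d L kappa b).
Local Notation alB := (aleph_bound m d L kappa b).
Local Notation stepB := (step_bound m d L eps kappa b).
Local Notation posB := (pos_bound m d L eps kappa b).
Local Notation incrB := (incr_bound m d L eps kappa b).
Local Notation gradB := (grad_bound m d L eps kappa b).

Let hlam1 (k : 'I_m) : (0 < k)%N -> lam`_k < 1.
Proof. by move=> k0; exact: le_lt_trans (hbeta k0) beta1. Qed.

Let mu0 : 0 < mu. Proof. exact: lt_le_trans hkappa. Qed.

Let kmu : 1 <= kappa^-1 * mu.
Proof. by rewrite mulrC ler_pdivlMr // mul1r. Qed.

Let bnds := bounds_gt0 m_gt0 d_gt0 L0 eps0 kappa0 b0.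
Let ib : 0 < initB. Proof. by case: bnds. Qed.
Let hb : 0 < hessB. Proof. by case: bnds. Qed.
Let nb : 0 < noiseB. Proof. by case: bnds. Qed.
Let gb : 0 < gapB. Proof. by case: bnds. Qed.
Let ab : 0 < alB. Proof. by case: bnds => ? ? ? ? []. Qed.
Let sb : 0 < stepB. Proof. by case: bnds => ? ? ? ? []. Qed.
Let pb : 0 < posB. Proof. by case: bnds => ? ? ? ? []. Qed.
Let inb : 0 < incrB. Proof. by case: bnds => ? ? ? ? []. Qed.
Let grb : 0 < gradB. Proof. by case: bnds => ? ? ? ? []. Qed.

Let Q1 : forall i k, `|Q i k| <= 1.
Proof. by move=> i k; apply: orthogonal_entry_le1; case: hQ. Qed.

Let QT1 : forall i k, `|Q^T i k| <= 1.
Proof. by move=> i k; rewrite mxE. Qed.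

Let Qmove n (t : nat) (x : 'M[R]_(m, n)) k j :
  (Q *m (A ^+ t *m x)) k j = lam`_k ^+ t * (Q *m x) k j.
Proof.
have [_ h _] := hQ.
by rewrite mulmxA h -mulmxA mul_diag_mx !mxE.
Qed.

Let Qinv n (x : 'M[R]_(m, n)) : x = Q^T *m (Q *m x).
Proof. by have [h _ _] := hQ; rewrite mulmxA (mulmx1C h) mul1mx. Qed.

Let L2_init x : `|x| <= b -> L2_le P (fun=> x) (initB * mu).
Proof.
move=> hx; apply: L2_le_cst; apply: le_trans hx _.
by rewrite /init_bound -mulrA ler_peMr // ltW.
Qed.

Let noise_fourth t i j :
  mean_le P (fun o => p t i o 0 j ^+ 4) (64 * mu ^+ 2).
Proof.
have M0 : 0 <= M j j.
  have [_ /(_ (delta_mx 0 j))] := hM.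
  by rewrite /qform -rowE trmx_delta -colE !mxE.
apply: mean_le_weak (gaussian_fourth_moment M0 (hp t i)).
rewrite ler_pM2l // lerXn2r ?nnegrE ?(ltW mu0) //.
by apply: le_trans (entry_le_opnorm M j j); exact: ler_norm.
Qed.

(** Bounded Hessian entries bound the quadratic form by [L * d] times the squared norm of the noise,
    at every position; fourth moments of the noise then bound the L^2 norm. *)
Lemma L2_le_hess t i : L2_le P
  (fun o => stacked_hess f (fun i => p t i o) (w t o) i 0) (hessB * mu).
Proof.
have h j : L2_le P (fun o => p t i o 0 j ^+ 2) (8 * mu).
  apply: mean_le_weak (mean_le_mono _ (noise_fourth t i j)).
    by rewrite le_eqVlt; apply/orP; left; apply/eqP; ring.
  by move=> o; rewrite -exprM.
have := L2_le_sum (mulr_gt0 (ltr0n R 8) mu0) h.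
have c0 : 0 <= L * d%:R by rewrite mulr_ge0 // ltW.
move=> /(L2_le_scale c0).
have -> : L * d%:R * (d%:R * (8 * mu)) = hessB * mu by rewrite /hess_bound; ring.
apply: L2_le_mono => o.
rewrite mxE hess_potential //.
have hN k l : `|(- hess (f i) (row i (w t o))) k l| <= L.
  by rewrite mxE normrN; exact: hL.
apply: le_trans (qform_le _ hN) _; exact: ler_norm.
Qed.

Let hess_gt0 : 0 < hessB * mu. Proof. exact: mulr_gt0. Qed.

Lemma L2_le_mixed_hess t k : L2_le P
  (fun o => (Q *m stacked_hess f (fun i => p t i o) (w t o)) k 0)
  (m%:R * (hessB * mu)).
Proof.
apply: (L2_le_mulmx (X := fun o => stacked_hess f (fun i => p t i o) (w t o)))
  => // i j.
by rewrite ord1; exact: L2_le_hess.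
Qed.

(* With [r t = al t - H (t - 1)] the recursion reads, on the eigenvector of
   eigenvalue [l], [r (t + 1) = l^t r t - (1 - l^t) H t], a convex combination;
   so no power of [1 - l] is lost here. *)
Lemma L2_le_aleph_gap t k : (0 < t)%N -> L2_le P
  (fun o => (Q *m (al t o - stacked_hess f (fun i => p t.-1 i o) (w t.-1 o))) k 0)
  (gapB * mu).
Proof.
elim: t => // -[|t] IH _.
  rewrite /aleph_gap_bound -mulrA mulrDl.
  apply: (L2_le_mulmx (X := fun o =>
    al 1%N o - stacked_hess f (fun i => p 0%N i o) (w 0%N o))) => //.
    by rewrite addr_gt0 // mulr_gt0.
  move=> i j; rewrite ord1.
  apply: (@L2_le_ext _ _ _ _ _ (fun o => al1 i 0 +
    - stacked_hess f (fun i => p 0%N i o) (w 0%N o) i 0)).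
    by move=> o; have [_ _ _ -> _] := hrun o; rewrite !mxE.
  apply: L2_leD => //; first by rewrite mulr_gt0.
  - exact: L2_init.
  - by apply: L2_leN; exact: L2_le_hess.
have lt01 : 0 <= lam`_k ^+ t.+1 <= 1.
  by have /andP[h0 h1] := hlam k; rewrite exprn_ge0 // exprn_ile1.
have hH : L2_le P (fun o =>
    - (Q *m stacked_hess f (fun i => p t.+1 i o) (w t.+1 o)) k 0) (gapB * mu).
  apply: L2_le_weak (L2_leN (L2_le_mixed_hess t.+1 k)).
    by rewrite mulr_ge0 // ltW.
  rewrite mulrA ler_pM2r // /aleph_gap_bound ler_wpM2l //.
  by rewrite lerDr ltW.
apply: L2_le_ext (L2_le_convex lt01 (IH isT) hH) => o.
have [_ _ _ _ /(_ t.+1 isT)[_ -> _]] := hrun o; rewrite /=.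
rewrite mulmxBr [LHS]mxE [X in _ + X]mxE Qmove.
set H1 := stacked_hess _ _ _; set H0 := stacked_hess _ _ _.
by rewrite addrAC mulmxDr [X in _ * X]mxE; ring.
Qed.

Lemma L2_le_mixed_aleph t k : (0 < t)%N ->
  L2_le P (fun o => (Q *m al t o) k 0) (alB * mu).
Proof.
move=> t0; have := L2_leD _ _ (L2_le_aleph_gap k t0) (L2_le_mixed_hess t.-1 k).
rewrite [X in _ -> _ -> L2_le _ _ (_ + X)]mulrA -mulrDl => h.
apply: L2_le_ext (h _ _).
- move=> o; by rewrite mulmxBr [X in _ = X + _]mxE [X in _ = _ + X + _]mxE subrK.
- by rewrite mulr_gt0.
- by rewrite mulr_gt0 // ltr0n.
Qed.

(** The mean component is included: the acceptance test reads [al] itself, so bounding its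
    dispersion alone would not do. *)
Lemma L2_le_aleph t i : (0 < t)%N ->
  L2_le P (fun o => al t o i 0) (m%:R * (alB * mu)).
Proof.
move=> t0.
apply: (@L2_le_ext _ _ _ _ _ (fun o => (Q^T *m (Q *m al t o)) i 0)).
  by move=> o; rewrite -Qinv.
apply: (L2_le_mulmx (X := fun o => Q *m al t o)) => //; first exact: mulr_gt0.
by move=> k j; rewrite ord1; exact: L2_le_mixed_aleph.
Qed.

(** The displacement before mixing; in the basis [Q] it is the forcing term of the recursion for
    [w]. *)
Definition mala_step t o := metropolis_step eps (fun i => p t i o)
  (fun i => u t i o) (w t o) (g t.+1 o) (al t.+1 o) - w t o.

Lemma L2_le_step t i j : (0 < t)%N ->
  L2_le P (fun o => mala_step t o i j) (stepB * mu).
Proof.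
move=> t0.
have hp2 : mean_le P (fun o => p t i o 0 j ^+ 2) ((noiseB * mu) ^+ 2).
  have h := mean_leD (mean_le_cst P ler01) (noise_fourth t i j).
  have h2 : (0 : R) <= 2^-1 by rewrite invr_ge0.
  apply: mean_le_weak (mean_le_mono _ (mean_leZ h2 h)).
    have -> : (noiseB * mu) ^+ 2 = 64 * mu ^+ 2 +
        16 * (mu * (kappa^-1 * mu)) + (kappa^-1 * mu) ^+ 2.
      by rewrite /noise_bound; ring.
    have := mulr_ge0 (ltW mu0) (ltW (lt_le_trans ltr01 kmu)).
    have : 1 <= (kappa^-1 * mu) ^+ 2 by rewrite expr_ge1 // (le_trans ler01).
    have := sqr_ge0 mu; lra.
  by move=> o; have := sqr_ge0 (p t i o 0 j ^+ 2 - 1); lra.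
(* The test performed at time [t] uses [al t.+1], hence the shifted index. *)
have hal := mean_leD (mean_le_cst P ler01) (L2_le_aleph i (ltn0Sn t)).
have hln := uniform_log_moment (hu t i).
have e2 : 0 <= 2 * eps ^+ 2 by rewrite mulr_ge0 // exprn_ge0 // ltW.
have e4 : 0 <= eps ^+ 4 by rewrite exprn_ge0 // ltW.
have e2' : 0 <= 4 * eps ^+ 2 by rewrite mulr_ge0 // exprn_ge0 // ltW.
apply: mean_le_weak (mean_le_mono _ (mean_leD
  (mean_leD (mean_leZ e2 hp2) (mean_leZ e4 hal)) (mean_leZ e2' hln))).
  (* [V * mu ^+ 2] bounds the second moment, and [V <= (1 + V) ^+ 2] turns it into an L^2 bound
     without a square root. *)
  set V := stepB - 1.
  have VE : V = 2 * eps ^+ 2 * noiseB ^+ 2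
      + eps ^+ 4 * (kappa ^- 2 + (m%:R * alB) ^+ 2) + 4 * eps ^+ 2 * kappa ^- 2.
    by rewrite /V /step_bound addrAC subrr add0r.
  have V0 : 0 <= V.
    rewrite VE.
    have k2 : 0 <= kappa ^- 2 by rewrite invr_ge0 exprn_ge0 // ltW.
    apply: addr_ge0; last exact: mulr_ge0.
    apply: addr_ge0; first by apply: mulr_ge0 => //; exact: sqr_ge0.
    by apply: mulr_ge0 => //; rewrite addr_ge0 // sqr_ge0.
  have kmu2 : 1 <= kappa ^- 2 * mu ^+ 2.
    by rewrite -exprVn -exprMn expr_ge1 // (le_trans ler01).
  apply: (@le_trans _ _ (V * mu ^+ 2)).
    rewrite VE.
    have h1 := ler_wpM2l e4 kmu2; have h2 := ler_wpM2l e2' kmu2.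
    rewrite [in leRHS]mulrDl [in leRHS]mulrDl.
    apply: lerD; last by rewrite -mulrA ler_wpM2l.
    apply: lerD; first by rewrite exprMn mulrA.
    rewrite -mulrA ler_wpM2l // [leRHS]mulrDl lerD //.
    by rewrite mulrA exprMn.
  have -> : stepB = 1 + V by rewrite /V addrCA subrr addr0.
  rewrite exprMn ler_wpM2r ?sqr_ge0 // sqrrD; have := sqr_ge0 V; lra.
move=> o; rewrite /mala_step /metropolis_step mxE [X in X + _]mxE.
case: ifPn => [h|_].
  rewrite [X in X + _]mxE [X in X + _ + _]mxE [X in _ + X]mxE addrAC subrr add0r.
  exact: accepted_step_sqr_le.
rewrite [X in X + _]mxE [X in _ + X]mxE subrr expr0n /=.
apply: addr_ge0; last by apply: mulr_ge0; rewrite // le_max lexx.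
by apply: addr_ge0; apply: mulr_ge0; rewrite ?addr_ge0 ?sqr_ge0.
Qed.

Let stepb : m%:R * (stepB * mu) <= posB * mu.
Proof. by rewrite mulrA ler_pM2r // ler_wpM2l // lerDl ltW. Qed.

Let posb : m%:R * (initB * mu) <= posB * mu.
Proof. by rewrite mulrA ler_pM2r // ler_wpM2l // lerDr ltW. Qed.

Let pos_gt0 : 0 < posB * mu. Proof. exact: mulr_gt0. Qed.

Lemma L2_le_mixed_step t k j : (0 < t)%N ->
  L2_le P (fun o => (Q *m mala_step t o) k j) (posB * mu).
Proof.
move=> t0; apply: L2_le_weak stepb _; first by rewrite mulr_ge0 // ltW // mulr_gt0.
apply: L2_le_mulmx => //; first exact: mulr_gt0.
by move=> i l; exact: L2_le_step.
Qed.

Let pos_rec t o k j : (0 < t)%N -> (Q *m w t.+1 o) k j =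
  lam`_k ^+ t * ((Q *m w t o) k j + (Q *m mala_step t o) k j).
Proof.
move=> t0; have [_ _ _ _ /(_ t t0)[_ _ ->]] := hrun o.
rewrite Qmove; congr (_ * _); rewrite /mala_step mulmxBr.
by rewrite [X in _ = _ + X]mxE [X in _ = _ + (_ + X)]mxE addrC subrK.
Qed.

Let L2_mixed_const n (x : 'M[R]_(m, n)) k j : (forall i j, `|x i j| <= b) ->
  L2_le P (fun=> (Q *m x) k j) (m%:R * (initB * mu)).
Proof.
move=> hx; apply: (L2_le_mulmx (X := fun=> x)) => //; first exact: mulr_gt0.
by move=> i l; exact: L2_init.
Qed.

Lemma L2_le_pos t (k : 'I_m) j : (0 < t)%N -> (0 < k)%N ->
  L2_le P (fun o => (1 - lam`_k ^+ t) * (Q *m w t o) k j) (8 * (posB * mu)) /\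
  L2_le P (fun o => (Q *m w t o) k j)
    (Num.sqrt (64 * (posB * mu) ^+ 2 / (1 - lam`_k))).
Proof.
move=> t0 k0; have /andP[l0 _] := hlam k.
apply: (L2_le_damped_weighted (Z := fun t o => (Q *m w t o) k j)
  (e := fun t o => (Q *m mala_step t o) k j)) => //.
- by rewrite l0 hlam1.
- apply: L2_le_weak posb _; first by rewrite mulr_ge0 // ltW // mulr_gt0.
  apply: L2_le_ext (L2_mixed_const k j hw1) => o.
  by have [_ -> _ _ _] := hrun o.
- by move=> s s0; exact: L2_le_mixed_step.
- by move=> s o s0; exact: pos_rec.
Qed.

(** On an eigenvector the increment is [l^t e - (1 - l^t) z], and the weighted bound controls the
    second term with no power of [1 - l]. The constant 9 is 1 for the first term plus 8 for the
    second, and [2 * initB] covers [w1 - w0] at [t = 1]. *)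
Lemma L2_le_incr t i j : (0 < t)%N ->
  L2_le P (fun o => (w t o - w t.-1 o) i j) (incrB * mu).
Proof.
case: t => // -[|t] _ /=.
  apply: (@L2_le_ext _ _ _ _ _ (fun o => w1 i j + - w0 i j)).
    by move=> o; have [-> -> _ _ _] := hrun o; rewrite !mxE.
  have h0 : `|- w0 i j| <= b by rewrite normrN.
  have := L2_leD (mulr_gt0 ib mu0) (mulr_gt0 ib mu0) (L2_init (hw1 i j))
    (L2_init h0).
  apply: L2_le_weak; first by rewrite addr_ge0 // ltW // mulr_gt0.
  rewrite -mulrDl ler_pM2r // /incr_bound [2 * _]mulr_natl mulr2n lerDr.
  by rewrite mulr_ge0 // mulr_ge0 // ltW.
apply: (@L2_le_ext _ _ _ _ _ (fun o => (Q^T *m (Q *m (w t.+2 o - w t.+1 o))) i j)).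
  by move=> o; rewrite -Qinv.
have c0 : 0 < 9 * (posB * mu) by rewrite mulr_gt0.
have h : L2_le P (fun o => (Q^T *m (Q *m (w t.+2 o - w t.+1 o))) i j)
    (m%:R * (9 * (posB * mu))).
  apply: (L2_le_mulmx (X := fun o => Q *m (w t.+2 o - w t.+1 o))) => // k l.
  have -> : 9 * (posB * mu) = posB * mu + 8 * (posB * mu) by ring.
  apply: (@L2_le_ext _ _ _ _ _ (fun o =>
     lam`_k ^+ t.+1 * (Q *m mala_step t.+1 o) k l
     + - ((1 - lam`_k ^+ t.+1) * (Q *m w t.+1 o) k l))).
    move=> o; rewrite mulmxBr [LHS]mxE [X in _ + X]mxE.
    by rewrite (pos_rec o k l (ltn0Sn t)); ring.
  apply: L2_leD => //; first by rewrite mulr_gt0.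
    apply: L2_le_mono (L2_le_mixed_step k l (ltn0Sn t)) => o.
    have /andP[l0 l1] := hlam k.
    by rewrite normrM ler_piMl // ger0_norm ?exprn_ge0 // exprn_ile1.
  (* On the mean component the eigenvalue is 1 and the weighted term is zero. *)
  apply: L2_leN; have [k0|k0] := posnP k.
    have -> : lam`_k = 1 by rewrite k0.
    have h0 : `|0 : R| <= 8 * (posB * mu) by rewrite normr0 mulr_ge0 // ltW.
    by apply: L2_le_ext (L2_le_cst P h0) => o; rewrite expr1n subrr mul0r.
  by have [] := L2_le_pos l (ltn0Sn t) k0.
apply: L2_le_weak h; first by rewrite mulr_ge0 // ltW.
have -> : m%:R * (9 * (posB * mu)) = m%:R * (9 * posB) * mu by ring.
by rewrite ler_pM2r // lerDl mulr_ge0 // ltW.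
Qed.

Let incr_gt0 : 0 < incrB * mu. Proof. exact: mulr_gt0. Qed.

Lemma L2_le_grad_incr t i j : (0 < t)%N -> L2_le P
  (fun o => (stacked_grad f (w t o) - stacked_grad f (w t.-1 o)) i j)
  (L * (d%:R * (incrB * mu))).
Proof.
move=> t0.
have h l : L2_le P (fun o => `|(w t o - w t.-1 o) i l|) (incrB * mu).
  by apply: L2_le_mono (L2_le_incr i l t0) => o; rewrite normr_id.
have := L2_le_scale (ltW L0) (L2_le_sum incr_gt0 h).
apply: L2_le_mono => o; apply: le_trans (ler_norm _).
have [_ hd] := hf i; rewrite mxE [X in `|_ + X|]mxE.
rewrite [stacked_grad _ _ _ _]mxE [X in `|_ - X|]mxE.
apply: le_trans (grad_lipschitz hd (hL i) _ _ j) _.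
apply: ler_wpM2l; first exact: ltW.
by apply: ler_sum => l _; rewrite !mxE.
Qed.

Let grad_gt0 : 0 < gradB * mu. Proof. exact: mulr_gt0. Qed.

(** The damped recursion again, now forced by gradient increments. These are bounded independently
    of the spectral gap, so the factor [(1 - l)^(-1/2)] occurs once and is not compounded with that
    of [w]. *)
Lemma L2_le_mixed_grad t (k : 'I_m) j : (0 < t)%N -> (0 < k)%N ->
  L2_le P (fun o => (Q *m g t o) k j)
    (Num.sqrt (64 * (gradB * mu) ^+ 2 / (1 - lam`_k))).
Proof.
move=> t0 k0; have /andP[l0 _] := hlam k.
have c0 : 0 < L * (d%:R * (incrB * mu)).
  by rewrite mulr_gt0 // mulr_gt0 // ltr0n.
suff [_ //] : L2_le P (fun o => (1 - lam`_k ^+ t) * (Q *m g t o) k j)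
    (8 * (gradB * mu)) /\ L2_le P (fun o => (Q *m g t o) k j)
    (Num.sqrt (64 * (gradB * mu) ^+ 2 / (1 - lam`_k))).
apply: (L2_le_damped_weighted (Z := fun t o => (Q *m g t o) k j)
  (e := fun t o => (Q *m (stacked_grad f (w t o)
                          - stacked_grad f (w t.-1 o))) k j)) => //.
- by rewrite l0 hlam1.
- apply: (@L2_le_weak _ _ _ _ _ (m%:R * (initB * mu))).
  + by rewrite mulr_ge0 // ltW // mulr_gt0.
  + rewrite mulrA ler_pM2r // ler_wpM2l // lerDr.
    by rewrite mulr_ge0 ?(ltW L0) // mulr_ge0 // ltW.
  apply: L2_le_ext (L2_mixed_const k j hg1) => o.
  by have [_ _ -> _ _] := hrun o.
- move=> s s0; apply: (@L2_le_weak _ _ _ _ _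
    (m%:R * (L * (d%:R * (incrB * mu))))).
  + by rewrite mulr_ge0 // ltW.
  + have -> : m%:R * (L * (d%:R * (incrB * mu))) =
      m%:R * (L * (d%:R * incrB)) * mu by ring.
    by rewrite ler_pM2r // ler_wpM2l // lerDl ltW.
  apply: (L2_le_mulmx (X := fun o => stacked_grad f (w s o)
    - stacked_grad f (w s.-1 o))) => // i l.
  exact: L2_le_grad_incr.
- move=> s o s0; have [_ _ _ _ /(_ s s0)[-> _ _]] := hrun o.
  by rewrite Qmove -addrA mulmxDr [X in _ * X]mxE.
Qed.

Lemma mean_le_consensus n (X : Om -> 'M[R]_(m, n)) v : 0 <= v ->
  (forall (k : 'I_m) j, (0 < k)%N ->
    mean_le P (fun o => (Q *m X o) k j ^+ 2) v) ->
  mean_le P (fun o => enorm (average (X o) - X o) ^+ 2) (m%:R * n%:R * v).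
Proof.
move=> v0 h.
have hs := mean_le_sum (index_enum 'I_m) (Q := fun k : 'I_m => (0 < k)%N)
  (fun k k0 => mean_le_sum (index_enum 'I_n) (Q := xpredT)
    (fun j _ => h k j k0)).
apply: mean_le_weak (mean_le_mono _ hs); last first.
  by move=> o; rewrite (consensus_error _ hQ).
apply: (@le_trans _ _ (\sum_(k < m) (v *+ n))); last first.
  by rewrite sumr_const card_ord -mulrA [n%:R * v]mulr_natl mulr_natl.
under eq_bigr do rewrite sumr_const card_ord.
rewrite [leRHS](bigID (fun k : 'I_m => (0 < k)%N)) /= lerDl sumr_ge0 // => k _.
exact: mulrn_wge0.
Qed.

Let L2_damped_unif (X : Om -> R) (k : 'I_m) c : 0 < c -> (0 < k)%N ->
  L2_le P X (Num.sqrt (64 * c ^+ 2 / (1 - lam`_k))) ->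
  mean_le P (fun o => X o ^+ 2) (64 * c ^+ 2 / (1 - beta)).
Proof.
move=> c0 k0; have c2 : 0 <= 64 * c ^+ 2 by rewrite mulr_ge0 // sqr_ge0.
have l1 : 0 < 1 - lam`_k by rewrite subr_gt0 hlam1.
rewrite /L2_le sqr_sqrtr; last by rewrite divr_ge0 // ltW.
apply: mean_le_weak; rewrite ler_wpM2l // lef_pV2 ?posrE ?subr_gt0 //.
  by rewrite lerB // hbeta.
exact: hlam1.
Qed.

Lemma mean_le_dispersion t : (0 < t)%N ->
  [/\ mean_le P (fun o => enorm (average (w t o) - w t o) ^+ 2)
        (m%:R * d%:R * (64 * (posB * mu) ^+ 2 / (1 - beta))),
      mean_le P (fun o => enorm (average (g t o) - g t o) ^+ 2)
        (m%:R * d%:R * (64 * (gradB * mu) ^+ 2 / (1 - beta))) &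
      mean_le P (fun o => enorm (average (al t o) - al t o) ^+ 2)
        (m%:R * 1%:R * (alB * mu) ^+ 2)].
Proof.
move=> t0; have h0 c : 0 <= 64 * c ^+ 2 / (1 - beta).
  apply: divr_ge0; last by rewrite subr_ge0 ltW.
  by apply: mulr_ge0 => //; exact: sqr_ge0.
split; apply: mean_le_consensus; try exact: h0; try exact: sqr_ge0.
- move=> k j k0; apply: (L2_damped_unif pos_gt0 k0).
  by have [] := L2_le_pos j t0 k0.
- move=> k j k0; apply: (L2_damped_unif grad_gt0 k0).
  exact: L2_le_mixed_grad.
- by move=> k j k0; rewrite ord1; exact: L2_le_mixed_aleph.
Qed.

End process.

(** * The constant and the two moment bounds *)

Lemma hess_entry_le (R : realType) (m d : nat) (f : 'I_m -> 'rV[R]_d -> R) c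
    i x k l : sup_hess f = c%:E -> `|hess (f i) x k l| <= c.
Proof.
move=> hc; apply: le_trans (entry_le_opnorm _ k l) _.
by rewrite -lee_fin -hc; apply: ereal_sup_ubound; exists i, x.
Qed.

(** The constant is fixed before the posteriors, the network and the noise, but after the
    dimensions, the initial values and the lower bound [kappa] on [opnorm M]: the right-hand sides
    vanish with [M], whereas the initial dispersion does not. *)
Theorem theorem3p2 (R : realType) (m d : nat) (hm : (1 < m)%N) (hd : (0 < d)%N)
    (L2 L3 eps : R) (heps : 0 < eps)
    (w0 w1 g1 : 'M[R]_(m, d)) (al1 : 'cV[R]_m) (kappa : R) (hkappa : 0 < kappa) :
  exists C : R, 0 < C /\
  forall (f : 'I_m -> 'rV[R]_d -> R) (E : rel 'I_m) (A : 'M[R]_m)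
    (lam : m.-tuple R) (beta : R) (M : 'M[R]_d)
    (dO : measure_display) (Om : measurableType dO) (P : probability Om R)
    (p : nat -> 'I_m -> Om -> 'rV[R]_d) (u : nat -> 'I_m -> Om -> R)
    (w g : nat -> Om -> 'M[R]_(m, d)) (al : nat -> Om -> 'cV[R]_m),
  (forall i, twice_differentiable (f i)) ->
  sup_hess f = L2%:E ->
  lip_hess f = L3%:E ->
  gossip_matrix E A lam ->
  beta = lam`_1 -> beta < 1 ->
  covariance_matrix M -> kappa <= opnorm M ->
  random_inputs P M p u ->
  decentralized_mala f A eps p u w0 w1 g1 al1 w g al ->
  forall t : nat, (1 <= t)%N ->
    ('E_P[(fun o => enorm (average (w t o) - w t o))]
     + 'E_P[(fun o => enorm (average (g t o) - g t o))]
     + 'E_P[(fun o => enorm (average (al t o) - al t o))]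
     <= (eps * C * opnorm M / (1 - beta))%:E)%E
    /\
    ('E_P[(fun o => enorm (average (w t o) - w t o) ^+ 2)%R]
     + 'E_P[(fun o => enorm (average (g t o) - g t o) ^+ 2)%R]
     + 'E_P[(fun o => enorm (average (al t o) - al t o) ^+ 2)%R]
     <= (eps ^+ 2 * C * opnorm M ^+ 2 / (1 - beta ^+ 2))%:E)%E.
Proof.
have m_gt0 : (0 < m)%N by exact: ltnW.
pose L := `|L2| + 1; have L0 : 0 < L by rewrite ltr_wpDl.
pose b := 1 + (enorm w0 + enorm w1 + enorm g1 + enorm al1).
have b0 : 0 < b by rewrite ltr_wpDr // !addr_ge0 // enorm_ge0.
pose K := total_bound m d L eps kappa b.
have K0 : 0 < K.
  have [_ _ _ _ [ab _ pb _ gb]] := bounds_gt0 m_gt0 hd L0 heps hkappa b0.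
  have m0 : 0 < m%:R :> R by rewrite ltr0n.
  have d0 : 0 < d%:R :> R by rewrite ltr0n.
  rewrite /K /total_bound addr_gt0 //; last by rewrite mulr_gt0 // exprn_gt0.
  by rewrite mulr_gt0 ?addr_gt0 ?exprn_gt0 // mulr_gt0 // mulr_gt0.
(* One summand for each estimate. The first needs [K + 3 <= eps * C], the 3 collecting a term
   [mu / 2] from each of the three dispersions; the second needs [2 * K <= eps ^+ 2 * C]. *)
pose C := 2 * K / eps ^+ 2 + (K + 3) / eps.
have e2 : 0 < eps ^+ 2 by rewrite exprn_gt0.
have CK1 : K + 3 <= eps * C.
  have -> : eps * C = 2 * K / eps + (K + 3) by rewrite /C; field; rewrite gt_eqF.
  by rewrite lerDr; apply: divr_ge0; [rewrite mulr_ge0 // ltW|exact: ltW].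
have CK2 : 2 * K <= eps ^+ 2 * C.
  have -> : eps ^+ 2 * C = 2 * K + (K + 3) * eps.
    by rewrite /C; field; rewrite gt_eqF.
  by rewrite lerDl; apply: mulr_ge0; [rewrite addr_ge0 // ltW|exact: ltW].
exists C; split.
  by rewrite -(pmulr_rgt0 _ heps) (lt_le_trans _ CK1) // addr_gt0.
move=> f E A lam beta M dO Om P p u w g al hf hL2 _ hg hbeta beta1 hM hk
  [hp hu _] hrun t t1.
have mu0 : 0 < opnorm M by exact: lt_le_trans hk.
have [Q hQ] := gossip_basis_exists hg.
have lam0 : lam`_0 = 1 by case: hg => _ _ _ _ [].
have lamb (k : 'I_m) : (0 < k)%N -> 0 <= lam`_k <= beta.
  by rewrite hbeta; exact: gossip_eigenvalue_bounds hg.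
have lam01 (k : 'I_m) : 0 <= lam`_k <= 1.
  have [k0|/lamb/andP[-> h]] := posnP k; last by rewrite (le_trans h) // ltW.
  by rewrite k0 lam0 ler01 lexx.
have beta0 : 0 <= beta.
  (* As [1 < m], position 1 of [lam] is a genuine eigenvalue and not the default value of [nth]. *)
  by have /andP[l0 l1] := lamb (Ordinal hm) isT; exact: le_trans l0 l1.
have hL i x k l : `|hess (f i) x k l| <= L.
  apply: le_trans (hess_entry_le i x k l hL2) _.
  by rewrite (le_trans (ler_norm _)) // lerDl.
have bw0 i j : `|w0 i j| <= b.
  apply: le_trans (entry_le_enorm _ _ _) _; rewrite /b.
  by have := (enorm_ge0 w1, enorm_ge0 g1, enorm_ge0 al1); case=> [[]]; lra.
have bw1 i j : `|w1 i j| <= b.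
  apply: le_trans (entry_le_enorm _ _ _) _; rewrite /b.
  by have := (enorm_ge0 w0, enorm_ge0 g1, enorm_ge0 al1); case=> [[]]; lra.
have bg1 i j : `|g1 i j| <= b.
  apply: le_trans (entry_le_enorm _ _ _) _; rewrite /b.
  by have := (enorm_ge0 w0, enorm_ge0 w1, enorm_ge0 al1); case=> [[]]; lra.
have bal1 i j : `|al1 i j| <= b.
  apply: le_trans (entry_le_enorm _ _ _) _; rewrite /b.
  by have := (enorm_ge0 w0, enorm_ge0 w1, enorm_ge0 g1); case=> [[]]; lra.
have [hw hgr hal] := mean_le_dispersion m_gt0 hd L0 heps hkappa b0 hf hL hQ lam01
  lam0 (fun k k0 => proj2 (andP (lamb k k0))) beta1 hM hk hp hu bw0 bw1 bg1 bal1
  hrun t1.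
set mu := opnorm M in mu0 hw hgr hal *.
set vw := m%:R * d%:R * (64 * _ / _) in hw.
set vg := m%:R * d%:R * (64 * _ / _) in hgr.
set va := m%:R * 1%:R * _ in hal.
have d1 : 0 < 1 - beta by rewrite subr_gt0.
(* The bound on [al] carries no factor [1 / (1 - beta)]; it is put over this denominator because
   [1 - beta <= 1]. *)
have sumv : vw + vg + va <= K * mu ^+ 2 / (1 - beta).
  rewrite ler_pdivlMr // [(_ + va) * _]mulrDl.
  have va0 : 0 <= va by rewrite /va mulr_ge0 ?sqr_ge0 // mulr_ge0.
  have : va * (1 - beta) <= va by rewrite ler_piMr // gerBl.
  have -> : (vw + vg) * (1 - beta) + va * (1 - beta) = K * mu ^+ 2 - va +
      va * (1 - beta).
    by rewrite /K /total_bound /vw /vg /va; field; rewrite gt_eqF.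
  lra.
have first (n : nat) (X : Om -> 'M[R]_(m, n)) v :
    mean_le P (fun o => enorm (average (X o) - X o) ^+ 2) v ->
    ('E_P[(fun o => enorm (average (X o) - X o))]
      <= ((2 * mu)^-1 * v + mu / 2)%:E)%E.
  move=> h; apply: le_expectation_mean_le; first by move=> o; exact: enorm_ge0.
  have k0 : 0 <= (2 * mu)^-1 by rewrite invr_ge0 mulr_ge0 // ltW.
  have k1 : 0 <= mu / 2 by rewrite divr_ge0 // ltW.
  apply: mean_le_mono (mean_leD (mean_leZ k0 h) (mean_le_cst P k1)) => o.
  set D := enorm _; rewrite -subr_ge0.
  have -> : (2 * mu)^-1 * D ^+ 2 + mu / 2 - D = (2 * mu)^-1 * (D - mu) ^+ 2.
    by field; rewrite gt_eqF.
  by rewrite mulr_ge0 // sqr_ge0.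
have second (n : nat) (X : Om -> 'M[R]_(m, n)) v :
    mean_le P (fun o => enorm (average (X o) - X o) ^+ 2) v ->
    ('E_P[(fun o => enorm (average (X o) - X o) ^+ 2)%R] <= v%:E)%E.
  by apply: le_expectation_mean_le => o; exact: sqr_ge0.
split.
  apply: le_trans (leeD (leeD (first _ _ _ hw) (first _ _ _ hgr))
    (first _ _ _ hal)) _.
  rewrite -!EFinD lee_fin.
  have -> : (2 * mu)^-1 * vw + mu / 2 + ((2 * mu)^-1 * vg + mu / 2)
     + ((2 * mu)^-1 * va + mu / 2) = (2 * mu)^-1 * (vw + vg + va) + 3 / 2 * mu.
    by field; rewrite gt_eqF.
  have k0 : 0 <= (2 * mu)^-1 by rewrite invr_ge0 mulr_ge0 // ltW.
  have h1 := ler_wpM2l k0 sumv.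
  have e1 : (2 * mu)^-1 * (K * mu ^+ 2 / (1 - beta)) = K / 2 * (mu / (1 - beta)).
    by field; rewrite !gt_eqF.
  rewrite e1 in h1; have h2 : mu <= mu / (1 - beta).
    by rewrite ler_pdivlMr // ler_piMr ?(ltW mu0) // gerBl.
  have h3 : 0 <= mu / (1 - beta) by rewrite divr_ge0 // ltW.
  rewrite -[leRHS]mulrA; apply: le_trans (ler_wpM2r h3 CK1).
  have := mulr_ge0 (ltW K0) h3; lra.
apply: le_trans (leeD (leeD (second _ _ _ hw) (second _ _ _ hgr))
  (second _ _ _ hal)) _.
rewrite -!EFinD lee_fin; apply: le_trans sumv _.
have b2 : 0 < 1 + beta by rewrite ltr_wpDr.
have e1 : 1 - beta ^+ 2 = (1 - beta) * (1 + beta) by ring.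
have d2 : 0 < 1 - beta ^+ 2 by rewrite e1 mulr_gt0.
(* Passing to the denominator [1 - beta ^+ 2] costs [1 + beta <= 2], the factor 2 in [CK2]. *)
have -> : K * mu ^+ 2 / (1 - beta) = (1 + beta) * K * (mu ^+ 2 / (1 - beta ^+ 2)).
  by rewrite e1; field; rewrite !gt_eqF.
rewrite -[leRHS]mulrA ler_wpM2r //; first by rewrite divr_ge0 ?sqr_ge0 // ltW.
by apply: le_trans CK2; rewrite ler_wpM2r ?(ltW K0) //; lra.
Qed.
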